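(* Let $(\Omega,\Sigma,\mu)$ be a complete, strictly localizable measure space, let $p\in[1,\infty]$, and let $F$ be a Banach space. Then for every local operator $T\in\mathscr{L}(L^p(\Omega;F'))$ there exists $M\in L^\infty_{\sigma^\ast}(\Omega;\mathscr{L}(F'))$ such that $\mathcal{M}_M=T$, i.e., such that (for a suitable representative $M\colon\Omega\to\mathscr{L}(F')$) for every $f\in L^p(\Omega;F')$ one has $(Tf)(\omega)=M(\omega)f(\omega)$ for almost every $\omega\in\Omega$.
   Context: **Local operators.** An operator $T\in\mathscr{L}(L^p(\Omega;F'))$ is local if for all $f\in L^p(\Omega;F')$ one has $Tf=0$ almost everywhere on $\{\omega:f(\omega)=0\}$; equivalently, $T(\mathbf{1}_Af)=\mathbf{1}_ATf$ for all $f\in L^p(\Omega;F')$ and $A\in\Sigma$. $L^p(\Omega;F')$ is the Bochner space of strongly measurable (i.e. weakly measurable and almost separably valued) functions. **Multipliers.** For a Banach space $G$ with closed unit ball $B_G$, $\mathcal{L}_{\sigma^\ast}(\Omega;G')$ is the space of functions $f\colon\Omega\to G'$ such that $\omega\mapsto\langle f(\omega),v\rangle$ is measurable for every $v\in G$ and $\|f\|_{\sigma^\ast}:=\sup_{v\in B_G}\operatorname{ess\,sup}_{\omega\in\Omega}|\langle f(\omega),v\rangle|<\infty$; $L^\infty_{\sigma^\ast}(\Omega;G')$ is its quotient by $\{f:\|f\|_{\sigma^\ast}=0\}$ with norm induced by $\|\cdot\|_{\sigma^\ast}$. Here $\mathscr{L}(F')$ is regarded as the dual of the projective tensor product $F'\tilde\otimes_\pi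 F$ via $\langle S,v'\otimes v\rangle=\langle Sv',v\rangle_{F',F}$, and $L^\infty_{\sigma^\ast}(\Omega;\mathscr{L}(F'))$ is formed with respect to this predual. For $M\in L^\infty_{\sigma^\ast}(\Omega;\mathscr{L}(F'))$ define $(\mathcal{M}_Mf)(\omega):=M(\omega)f(\omega)$. **Measure theory.** $(\Omega,\Sigma,\mu)$ is strictly localizable if there is a partition $(A_\alpha)_{\alpha\in I}$ of $\Omega$ into measurable sets of finite measure such that $B\subset\Omega$ is in $\Sigma$ if and only if $B\cap A_\alpha\in\Sigma$ for all $\alpha$, and $\mu(B)=\sum_\alpha\mu(B\cap A_\alpha)$ for $B\in\Sigma$. *)

(* Defs.v *)
From HB Require Import structures.
From mathcomp Require Import all_boot all_order all_algebra.
From mathcomp Require Import complex.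
From mathcomp Require Import all_classical all_reals all_analysis.
From mathcomp Require Import ess_sup_inf.

Set Implicit Arguments.
Unset Strict Implicit.
Unset Printing Implicit Defensive.

Import Order.TTheory GRing.Theory Num.Theory.
Import numFieldNormedType.Exports.
Local Open Scope classical_set_scope.
Local Open Scope ring_scope.

(** Banach spaces are real or complex; [k] selects the scalar field.  The norm
    of a [normedModType K] takes its values in [K]; [toR] brings it back to
    the reals, and [ofR] is the inclusion of the reals into [K]. *)
Variant scalars := RealScalars | ComplexScalars.

Definition scalar_field (R : realType) (k : scalars) : numFieldType :=
  match k with RealScalars => R | ComplexScalars => R[i] end.

Definition toR (R : realType) (k : scalars) : scalar_field R k -> R :=
  match k with RealScalars => fun z => z | ComplexScalars => fun z => complex.Re z end.

Definition ofR (R : realType) (k : scalars) : R -> scalar_field R k :=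
  match k with RealScalars => fun r => r | ComplexScalars => fun r => r%:C%C end.

Section scalar_field_theory.
Context {R : realType} {k : scalars}.
Local Notation K := (scalar_field R k).
Implicit Types (r s : R) (z : K).

Lemma ofRK r : toR (ofR k r) = r. Proof. by case: k. Qed.

Lemma ofRD r s : ofR k (r + s) = ofR k r + ofR k s.
Proof. by case: k => //=; rewrite rmorphD. Qed.

Lemma ofRM r s : ofR k (r * s) = ofR k r * ofR k s.
Proof. by case: k => //=; rewrite rmorphM. Qed.

Lemma ofR0 : ofR k (0 : R) = 0. Proof. by case: k. Qed.

Lemma ler_ofR r s : (ofR k r <= ofR k s) = (r <= s).
Proof. by case: k => //=; rewrite lecR. Qed.

Lemma toRK z : 0 <= z -> ofR k (toR z) = z.
Proof. by case: k z => //= z; case: z => a b; rewrite lecE /= => /andP[/eqP -> _]. Qed.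

End scalar_field_theory.

Section real_norm.
Context {R : realType} {k : scalars}.
Local Notation K := (scalar_field R k).

Definition rnorm (E : normedModType K) (x : E) : R := toR `|x|.

Variable E : normedModType K.
Implicit Types (x y : E).

Lemma rnormK x : ofR k (rnorm x) = `|x|. Proof. by rewrite toRK. Qed.

Lemma rnorm_ge0 x : 0 <= rnorm x.
Proof. by rewrite -(ler_ofR (k := k)) rnormK ofR0. Qed.

Lemma rnorm0 : rnorm (0 : E) = 0.
Proof. by rewrite /rnorm normr0 -(ofR0 (k := k)) ofRK. Qed.

Lemma rnorm_eq0 x : rnorm x = 0 -> x = 0.
Proof. by move=> x0; apply/normr0_eq0; rewrite -rnormK x0 ofR0. Qed.

Lemma ler_rnormD x y : rnorm (x + y) <= rnorm x + rnorm y.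
Proof. by rewrite -(ler_ofR (k := k)) ofRD !rnormK ler_normD. Qed.

Lemma rnormZ (a : K) x : rnorm (a *: x) = toR `|a| * rnorm x.
Proof.
by rewrite -[LHS](ofRK (k := k)) -[RHS](ofRK (k := k)) ofRM !rnormK toRK// normrZ.
Qed.

End real_norm.

Section bounded_operators.
Context {R : realType} {k : scalars}.
Local Notation K := (scalar_field R k).
Variables E F : normedModType K.

Definition is_bounded_operator : pred (E -> F) :=
  fun f => `[< linear f /\ continuous f >].

Record bounded_operator := BoundedOperator {
  operator_fun :> E -> F ;
  _ : is_bounded_operator operator_fun
}.

HB.instance Definition _ := [isSub of bounded_operator for operator_fun].
HB.instance Definition _ := [Choice of bounded_operator by <:].

Lemma is_bounded_operator_submod_closed : submod_closed is_bounded_operator.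
Proof.
split.
  apply/asboolP; split; first by move=> a x y; rewrite -[LHS]/0 -[0 _]/0 -[0 y]/0 scaler0 addr0.
  by move=> x; exact: cvg_cst.
move=> a f g /asboolP[lf cf] /asboolP[lg cg]; apply/asboolP; split.
  move=> b x y; rewrite -[LHS]/(a *: f _ + g _) -[RHS]/(b *: (a *: f x + g x) + (a *: f y + g y)) lf lg !scalerDr !scalerA (mulrC a b).
  by rewrite addrACA.
by move=> x; apply: cvgD; [apply: cvgZl_tmp; exact: cf|exact: cg].
Qed.

HB.instance Definition _ := GRing.isSubmodClosed.Build K (E -> F)
  is_bounded_operator is_bounded_operator_submod_closed.
HB.instance Definition _ :=
  [SubChoice_isSubLmodule of bounded_operator by <:].

Implicit Types S : bounded_operator.

Lemma bounded_operator_linear S : linear S.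
Proof. by case: S => f /= /asboolP[]. Qed.

Lemma bounded_operator_continuous S : continuous S.
Proof. by case: S => f /= /asboolP[]. Qed.

HB.instance Definition _ S :=
  GRing.isLinear.Build K E F *:%R S (@bounded_operator_linear S).

Definition opnorm S : R := sup [set rnorm (S x) | x in [set x | rnorm x <= 1]].

Lemma bounded_operator_ball S :
  has_sup [set rnorm (S x) | x in [set x | rnorm x <= 1]].
Proof.
split; first by exists (rnorm (S 0)), 0; rewrite //= rnorm0 ler01.
have /linear_bounded_continuous/linear_boundedP := @bounded_operator_continuous S.
move=> /pinfty_ex_gt0[r r0 Sr]; exists (toR r) => _ [x /= x1 <-].
rewrite -(ler_ofR (k := k)) rnormK (toRK (ltW r0)).
apply: (le_trans (Sr x)); rewrite -[leRHS]mulr1 ler_pM2l//.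
by rewrite -rnormK (_ : 1 = ofR k 1) ?ler_ofR//; case: k.
Qed.

Lemma opnorm_ub S x : rnorm x <= 1 -> rnorm (S x) <= opnorm S.
Proof.
move=> x1; have [_ ubS] := bounded_operator_ball S.
by apply: ub_le_sup => //; exists x.
Qed.

Lemma opnorm_le S c :
  (forall x, rnorm x <= 1 -> rnorm (S x) <= c) -> opnorm S <= c.
Proof.
move=> Sc; have [S0 _] := bounded_operator_ball S.
by apply: ge_sup => // _ [x /= x1 <-]; exact: Sc.
Qed.

Lemma opnorm_ge0 S : 0 <= opnorm S.
Proof.
by apply: (le_trans (rnorm_ge0 (S 0))); apply: opnorm_ub; rewrite rnorm0.
Qed.

Lemma opnormP S x : rnorm (S x) <= opnorm S * rnorm x.
Proof.
have [->|x0] := eqVneq x 0; first by rewrite linear0 !rnorm0 mulr0.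
have px : 0 < rnorm x.
  rewrite lt_def rnorm_ge0 andbT; apply: contra x0 => /eqP x0.
  exact/eqP/rnorm_eq0.
rewrite -ler_pdivrMr//.
have nE : toR `|ofR k (rnorm x)^-1| = (rnorm x)^-1.
  by rewrite ger0_norm ?ofRK// -(ofR0 (k := k)) ler_ofR invr_ge0 ltW.
have := @opnorm_ub S (ofR k (rnorm x)^-1 *: x).
rewrite linearZ/= !rnormZ nE mulVf ?gt_eqF// lexx => /(_ isT).
by rewrite mulrC.
Qed.

Lemma ler_opnormD S S' :
  ofR k (opnorm (S + S')) <= ofR k (opnorm S) + ofR k (opnorm S').
Proof.
rewrite -ofRD ler_ofR; apply: opnorm_le => x x1.
by apply: (le_trans (ler_rnormD _ _)); apply: lerD; exact: opnorm_ub.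
Qed.

Lemma opnormZ_le (a : K) S : opnorm (a *: S) <= toR `|a| * opnorm S.
Proof.
apply: opnorm_le => x x1; rewrite rnormZ ler_wpM2l ?opnorm_ub//.
by rewrite -(ler_ofR (k := k)) toRK ?ofR0.
Qed.

Lemma opnormZ (a : K) S : ofR k (opnorm (a *: S)) = `|a| * ofR k (opnorm S).
Proof.
rewrite -[`|a|]toRK// -ofRM; congr ofR.
apply/eqP; rewrite eq_le opnormZ_le /=.
have [->|a0] := eqVneq a 0.
  by rewrite normr0 -(ofR0 (k := k)) ofRK mul0r opnorm_ge0.
have pa : 0 < toR `|a|.
  rewrite lt_def -(ler_ofR (k := k)) toRK// ofR0 normr_ge0 andbT.
  by apply: contra a0 => /eqP a0; rewrite -normr_eq0 -[`|a|]toRK// a0 ofR0.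
rewrite -ler_pdivlMl//; have := opnormZ_le a^-1 (a *: S).
rewrite scalerA mulVf// scale1r normfV => /le_trans; apply.
rewrite ler_wpM2r ?opnorm_ge0// le_eqVlt; apply/orP; left; apply/eqP.
apply: (mulfI (lt0r_neq0 pa)); rewrite mulfV ?lt0r_neq0//.
rewrite -[LHS](ofRK (k := k)) ofRM !toRK ?invr_ge0// mulfV ?normr_eq0//.
by case: k.
Qed.

Lemma opnorm_eq0 S : ofR k (opnorm S) = 0 -> S = 0.
Proof.
move=> S0; have {}S0 : opnorm S = 0.
  by rewrite -(ofRK (k := k) (opnorm S)) S0 -(ofR0 (k := k)) ofRK.
apply/val_inj/funext => x /=; apply/rnorm_eq0/eqP.
by rewrite eq_le rnorm_ge0 andbT (le_trans (opnormP S x))// S0 mul0r.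
Qed.

HB.instance Definition _ := Lmodule_isNormed.Build K bounded_operator
  ler_opnormD opnormZ opnorm_eq0.

Lemma rnorm_opnorm S : rnorm S = opnorm S.
Proof. exact: ofRK. Qed.

End bounded_operators.

Notation "''L' ( E , F )" := (bounded_operator E F)
  (at level 8, format "''L' ( E ,  F )") : type_scope.

Definition dual (R : realType) (k : scalars)
    (E : normedModType (scalar_field R k)) : normedModType (scalar_field R k) :=
  'L(E, (scalar_field R k)^o).

(** The completed projective tensor product of [E] and [F].

    A finite formal sum [s : seq (E * F)] represents the element
    [\sum_(z <- s) z.1 (x) z.2] of the algebraic tensor product; two formal
    sums represent the same element iff no bilinear map distinguishes them
    (universal property).  The completion consists of the Cauchy sequences for
    the projective norm; as usual, sequences at distance 0 represent the same
    element, and the norm and the duality pairing do not depend on the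
    representative. *)
Section projective_tensor_product.
Context {R : realType} {k : scalars}.
Local Notation K := (scalar_field R k).
Variables E F : normedModType K.

Definition tensor := seq (E * F).

Implicit Types s t : tensor.

Definition tensor_eq s t : Prop :=
  forall (V : lmodType K) (b : {bilinear E -> F -> V}),
    \sum_(z <- s) b z.1 z.2 = \sum_(z <- t) b z.1 z.2.

Definition tensor_sub s t : tensor := s ++ [seq (- z.1, z.2) | z <- t].

Definition projective_norm s : R :=
  inf [set \sum_(z <- t) rnorm z.1 * rnorm z.2 | t in tensor_eq s].

Definition projective_cauchy (u : nat -> tensor) : Prop :=
  forall e : R, 0 < e -> exists N, forall m n, (N <= m)%N -> (N <= n)%N ->
    projective_norm (tensor_sub (u m) (u n)) < e.

Record ptensor := PTensor {
  ptensor_seq :> nat -> tensor ;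
  ptensor_cauchy : projective_cauchy ptensor_seq
}.

Definition ptensor_norm (u : ptensor) : R :=
  lim (projective_norm (u n) @[n --> \oo]).

Definition ptensor_ball : set ptensor := [set u | ptensor_norm u <= 1].

End projective_tensor_product.

(** The duality between [L(F')] and the completed projective tensor product of
    [F'] and [F], extending [<S, v' (x) v> = <S v', v>].  The limit exists by
    [tensor_pairing_eq] and [tensor_pairing_le]. *)
Section operator_pairing.
Context {R : realType} {k : scalars}.
Local Notation K := (scalar_field R k).
Variable F : normedModType K.
Implicit Types (S : 'L(dual F, dual F)) (s t : tensor (dual F) F).

Definition tensor_pairing S s : K := \sum_(z <- s) (S z.1 : dual F) z.2.

Definition operator_pairing S (v : ptensor (dual F) F) : K :=
  lim (tensor_pairing S (v n) @[n --> \oo]).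

Definition pairing_form S (x : dual F) (y : F) : K^o := (S x : dual F) y.

Lemma pairing_form_bilinear S : bilinear_for *:%R *:%R (pairing_form S).
Proof.
split=> [y|x] a u v; rewrite /pairing_form; last by rewrite linearP.
by rewrite linearP.
Qed.

HB.instance Definition _ S := bilinear_isBilinear.Build K (dual F) F K^o
  *:%R *:%R (pairing_form S) (pairing_form_bilinear S).

Lemma tensor_pairing_eq S s t :
  tensor_eq s t -> tensor_pairing S s = tensor_pairing S t.
Proof. by move=> /(_ K^o (pairing_form S)). Qed.

Lemma tensor_pairing_sub S s t :
  tensor_pairing S (tensor_sub s t) = tensor_pairing S s - tensor_pairing S t.
Proof.
rewrite /tensor_pairing big_cat big_map /= -sumrN; congr (_ + _).
by apply: eq_bigr => z _; rewrite linearN.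
Qed.

Lemma tensor_pairing_le S s :
  toR `|tensor_pairing S s| <= opnorm S * projective_norm s.
Proof.
have le1 t : toR `|tensor_pairing S t| <=
    opnorm S * \sum_(z <- t) rnorm z.1 * rnorm z.2.
  rewrite /tensor_pairing mulr_sumr; elim/big_ind2: _ => [|x r y r' rx r'y|z _].
  - by rewrite normr0 -(ofR0 (k := k)) ofRK.
  - exact: (le_trans (ler_rnormD r r') (lerD rx r'y)).
  rewrite mulrA; apply: (le_trans (opnormP (S z.1) z.2)).
  by rewrite -rnorm_opnorm ler_wpM2r ?rnorm_ge0 ?opnormP.
have [S0|S0] := eqVneq (opnorm S) 0; first by have := le1 s; rewrite S0 !mul0r.
have {}S0 : 0 < opnorm S by rewrite lt_def S0 opnorm_ge0.
rewrite -ler_pdivrMl//; apply: lb_le_inf.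
  by exists (\sum_(z <- s) rnorm z.1 * rnorm z.2), s.
by move=> _ [t /= st <-]; rewrite ler_pdivrMl// (tensor_pairing_eq S st).
Qed.

End operator_pairing.

Section measurable_functions.
Context {d : measure_display} {Omega : measurableType d} {R : realType}.
Context {k : scalars}.
Variable mu : {measure set Omega -> \bar R}.
Local Notation K := (scalar_field R k).

(** Empty pieces [A i] are allowed. *)
Definition strictly_localizable : Prop :=
  exists (I : choiceType) (A : I -> set Omega),
    [/\ \bigcup_i A i = [set: Omega],
        trivIset [set: I] A,
        forall i, measurable (A i) /\ (mu (A i) < +oo)%E,
        forall B : set Omega, measurable B <-> forall i, measurable (B `&` A i)
      & forall B : set Omega, measurable B ->
          mu B = \esum_(i in [set: I]) mu (B `&` A i)].

Definition scalar_measurable (g : Omega -> K) : Prop :=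
  measurable_fun [set: Omega] (g : Omega -> g_sigma_algebraType (@open K)).

Section bochner_spaces.
Variable E : normedModType K.
Implicit Types f g : Omega -> E.

Definition weakly_measurable f : Prop :=
  forall phi : dual E, scalar_measurable (fun w => phi (f w)).

Definition almost_separably_valued f : Prop :=
  exists2 D : set E, countable D & {ae mu, forall w, closure D (f w)}.

Definition strongly_measurable f : Prop :=
  weakly_measurable f /\ almost_separably_valued f.

Variable p : \bar R.

Definition bochner_norm f : \bar R := Lnorm mu p (fun w => (rnorm (f w))%:E).

(** Representatives of the elements of [L^p(Omega; E)]. *)
Definition in_Lp f : Prop := strongly_measurable f /\ (bochner_norm f < +oo)%E.

(** [T] induces a bounded linear operator on the quotient [L^p(Omega; E)] of
    [in_Lp] by almost everywhere equality; values outside [in_Lp] are junk. *)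
Definition Lp_operator (T : (Omega -> E) -> (Omega -> E)) : Prop :=
  [/\ forall f, in_Lp f -> in_Lp (T f),
      forall f g, in_Lp f -> in_Lp g ->
        {ae mu, forall w, f w = g w} -> {ae mu, forall w, T f w = T g w},
      forall (a : K) f g, in_Lp f -> in_Lp g ->
        {ae mu, forall w, T (fun x => a *: f x + g x) w = a *: T f w + T g w}
    & exists C : R, forall f, in_Lp f ->
        (bochner_norm (T f) <= C%:E * bochner_norm f)%E].

Definition local_operator (T : (Omega -> E) -> (Omega -> E)) : Prop :=
  forall f, in_Lp f -> {ae mu, forall w, f w = 0 -> T f w = 0}.

End bochner_spaces.

(** Membership in the space of weak* measurable functions from [Omega] to the
    dual of a space [G] with closed unit ball [ball], the value at [w] being
    known through its pairing [pair w] with the elements of [G]. *)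
Definition sigma_star_norm (G : Type) (ball : set G) (pair : Omega -> G -> K) :
    \bar R :=
  ereal_sup [set ess_sup mu (fun w => (toR `|pair w v|)%:E) | v in ball].

Definition in_Lsigma_star (G : Type) (ball : set G) (pair : Omega -> G -> K) :
    Prop :=
  (forall v, scalar_measurable (pair^~ v)) /\
  (sigma_star_norm ball pair < +oo)%E.

(** [L^oo_sigma*(Omega; L(F'))], for the predual [F' (x)_pi F] of [L(F')]. *)
Definition operator_Lsigma_star (F : normedModType K)
    (M : Omega -> 'L(dual F, dual F)) : Prop :=
  in_Lsigma_star (@ptensor_ball R k (dual F) F)
    (fun w => operator_pairing (M w)).

Definition multiplier (E : normedModType K) (M : Omega -> 'L(E, E))
    (f : Omega -> E) : Omega -> E := fun w => M w (f w).

End measurable_functions.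

(* Main.v *)
Require Import Defs.
From HB Require Import structures.
From mathcomp Require Import all_boot all_order all_algebra.
From mathcomp Require Import complex.
From mathcomp Require Import all_classical all_reals all_analysis.
From mathcomp Require Import measurable_realfun ess_sup_inf lra.

Set Implicit Arguments.
Unset Strict Implicit.
Unset Printing Implicit Defensive.

Import Order.TTheory GRing.Theory Num.Theory.
Import numFieldNormedType.Exports.
Local Open Scope classical_set_scope.
Local Open Scope ring_scope.

(** The operator is read off from its values on the functions [1_A x], where [A]
    is a piece of the localization and [x] a constant of [F'].  By locality and
    boundedness these values glue to essentially bounded functions [h x], almost
    everywhere linear in [x]; the point is to choose representatives of
    [<h x, v>] which are bilinear in [(x, v)] everywhere.

    This is done by a von Neumann--Maharam lifting, in the form of a family of
    ultrafilters [U w] on the whole space, such that [U w] contains every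
    conull set and every measurable [E] belongs to [U w] for almost every [w] in
    [E].  The value [M(w) x] at [v] is the limit of [<h x, v>] along [U w].  As
    [h x] is almost separably valued, [M x = h x] almost everywhere,
    simultaneously for all [v]; locality then extends the identity from
    constants to [L^p].

    The lifting is obtained by Zorn's lemma on sub-sigma-algebras.  A maximal one
    contains every measurable set, since one set can always be adjoined.  For
    chains of countable cofinality, instead of martingale convergence, the
    proof uses a maximal inequality for Hahn decompositions relative to the
    sub-sigma-algebras; other chains have a sigma-algebra as union. *)

(** * Liftings of finite measures *)

Section sub_sigma_algebras.
Context {d : measure_display} {T : measurableType d}.
Implicit Types (B : set (set T)) (C D E H : set T).

Definition sub_sigma B := sigma_algebra setT B /\ B `<=` measurable.

Lemma sub_sigmaC B E : sub_sigma B -> B E -> B (~` E).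
Proof. by move=> [[_ BC _] _] /BC; rewrite setTD. Qed.

Lemma sub_sigma0 B : sub_sigma B -> B set0.
Proof. by case=> -[]. Qed.

Lemma sub_sigmaT B : sub_sigma B -> B setT.
Proof. by move=> Bs; rewrite -setC0; apply: sub_sigmaC (sub_sigma0 Bs). Qed.

Lemma sub_sigma_measurable B E : sub_sigma B -> B E -> measurable E.
Proof. by case=> _; exact. Qed.

Lemma sub_sigma_bigcup B (E : nat -> set T) :
  sub_sigma B -> (forall n, B (E n)) -> B (\bigcup_n E n).
Proof. by move=> [[_ _ BU] _]; exact: BU. Qed.

Lemma sub_sigmaU B E H : sub_sigma B -> B E -> B H -> B (E `|` H).
Proof.
move=> Bs BE BH; rewrite -bigcup2E; apply: (sub_sigma_bigcup (E := bigcup2 E H)) => //.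
by case=> [//|[//|n]]; case: Bs => -[].
Qed.

Lemma sub_sigmaI B E H : sub_sigma B -> B E -> B H -> B (E `&` H).
Proof.
move=> Bs BE BH; rewrite -(setCK (E `&` H)) setCI.
by apply: sub_sigmaC => //; apply: sub_sigmaU => //; exact: sub_sigmaC.
Qed.

Lemma sub_sigmaD B E H : sub_sigma B -> B E -> B H -> B (E `\` H).
Proof. by move=> Bs BE BH; rewrite setDE; apply: sub_sigmaI => //; exact: sub_sigmaC. Qed.

Lemma sub_sigma_bigcap B (E : nat -> set T) :
  sub_sigma B -> (forall n, B (E n)) -> B (\bigcap_n E n).
Proof.
move=> Bs BE; rewrite -(setCK (\bigcap_n E n)) setC_bigcap.
by apply: sub_sigmaC => //; apply: sub_sigma_bigcup => // n; exact: sub_sigmaC.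
Qed.

End sub_sigma_algebras.

Section charge_on_sub_sigma.
Context {d : measure_display} {T : measurableType d} {R : realType}.
Variables (B : set (set T)) (Bs : sub_sigma B) (nu : {charge set T -> \bar R}).

(** On [g_sigma_algebraType B] the measurable sets are the members of [B], so Hahn's theorem for
    charges applies relative to [B]. The proof of [sub_sigma B] is carried in the term so that the
    charge structure can be inferred from it. *)
Definition restricted_charge of sub_sigma B :
  set (g_sigma_algebraType B) -> \bar R := nu.
Local Notation nuB := (restricted_charge Bs).

Let measurable_restricted (E : set (g_sigma_algebraType B)) :
  measurable E -> (measurable : set (set T)) E.
Proof. by case: Bs => sB BT; rewrite [X in X E -> _]sigma_algebra_id //; exact: BT. Qed.

Let nuB0 : nuB set0 = 0%E. Proof. exact: charge0. Qed.
Let nuB_fin E : measurable E -> nuB E \is a fin_num.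
Proof. by move=> /measurable_restricted; exact: fin_num_measure. Qed.
Let nuB_sigma_additive : semi_sigma_additive nuB.
Proof.
move=> F mF tF mUF; apply: charge_semi_sigma_additive => //.
- by move=> i; exact/measurable_restricted.
- exact/measurable_restricted.
Qed.

HB.instance Definition _ := isCharge.Build _ _ _ nuB nuB0 nuB_fin nuB_sigma_additive.

Lemma sub_sigma_Hahn : exists H, [/\ B H,
  forall C, B C -> C `<=` H -> (0 <= nu C)%E &
  forall C, B C -> C `&` H = set0 -> (nu C <= 0)%E].
Proof.
have mB C : B C = (measurable : set (set (g_sigma_algebraType B))) C.
  by rewrite -[RHS]/(<<s B >> C) sigma_algebra_id //; case: Bs.
have [H [N [[mH posH] [mN negN] HN HN0]]] := Hahn_decomposition nuB.
exists H; split=> [|C|C]; rewrite mB // => mC CH; first exact: posH.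
apply: negN => // x Cx; have : setT x by [].
by rewrite -HN => -[Hx|//]; have : (C `&` H) x by []; rewrite CH.
Qed.

End charge_on_sub_sigma.

Section finite_measure_reals.
Context {d : measure_display} {T : measurableType d} {R : realType}.
Variable mu : {finite_measure set T -> \bar R}.
Implicit Types (C D E H : set T).
Local Notation m E := (fine (mu E)).

Lemma fine_meas_ge0 E : 0 <= m E. Proof. exact/fine_ge0. Qed.

Lemma fine_meas_le E H : measurable E -> measurable H -> E `<=` H -> m E <= m H.
Proof.
by move=> mE mH EH; rewrite fine_le ?fin_num_measure// le_measure// inE.
Qed.

Lemma fine_meas_split E H : measurable E -> measurable H ->
  m E = m (E `&` H) + m (E `\` H).
Proof.
move=> mE mH; rewrite -fineD ?fin_num_measure//; last 2 first.
  exact: measurableI.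
  exact: measurableD.
by rewrite [in LHS](measureDI mu mE mH) addeC.
Qed.

Lemma fine_meas_U E H : measurable E -> measurable H -> m (E `|` H) <= m E + m H.
Proof.
move=> mE mH; rewrite -fineD ?fin_num_measure// fine_le ?fin_num_measure//.
- exact: measurableU.
- by rewrite fin_numD !fin_num_measure.
- exact: measureU2.
Qed.

Lemma fine_meas_null E : measurable E -> m E = 0 -> mu.-negligible E.
Proof.
move=> mE E0; apply/negligibleP => //.
by rewrite -[LHS]fineK ?fin_num_measure// E0.
Qed.

Lemma fine_meas_eps_null E : measurable E -> (forall e, 0 < e -> m E <= e) ->
  mu.-negligible E.
Proof.
move=> mE Ee; apply: fine_meas_null => //; apply/eqP.
rewrite eq_le fine_meas_ge0 andbT; apply/ler_addgt0Pr => e /Ee; by rewrite add0r.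
Qed.

(** Hahn decomposition, relative to [B], of the charge [C |-> s * m C - m (C \ E)]. The set [H]
    plays the role of the region where the conditional probability of the complement of [E] given
    [B] is at most [s], without any conditional expectation. *)
Lemma sub_sigma_density (B : set (set T)) E (s : R) :
  sub_sigma B -> measurable E ->
  exists H, [/\ B H,
    forall C, B C -> C `<=` H -> m (C `\` E) <= s * m C &
    forall C, B C -> C `&` H = set0 -> s * m C <= m (C `\` E)].
Proof.
move=> Bs mE.
pose c1 : {charge set T -> \bar R} := cscale s (charge_of_finite_measure mu).
pose c2 : {charge set T -> \bar R} :=
  crestr (charge_of_finite_measure mu) (measurableC mE).
pose nu : {charge set T -> \bar R} := cadd c1 (cscale (-1) c2).
have nuE C : measurable C -> nu C = (s * m C - m (C `\` E))%:E.
  move=> mC; rewrite /nu /= /cadd /c1 /c2 /= /cscale /crestr /charge_of_finite_measure.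
  rewrite EFinB EFinM fineK ?fin_num_measure// fineK ?setDE ?mulN1e//.
  by rewrite -setDE fin_num_measure//; exact: measurableD.
have [H [BH posH negH]] := sub_sigma_Hahn Bs nu.
exists H; split=> // C BC CH; have mC : measurable C by case: Bs => _; exact.
- by have := posH _ BC CH; rewrite nuE// lee_fin subr_ge0.
- by have := negH _ BC CH; rewrite nuE// lee_fin subr_le0.
Qed.

End finite_measure_reals.

(** * Liftings as families of ultrafilters *)

Section liftings.
Context {d : measure_display} {T : measurableType d} {R : realType}.
Variable mu : {measure set T -> \bar R}.
Implicit Types (B : set (set T)) (C D E H N : set T) (U V : T -> set_system T).

(** Encodes the map [E |-> [set w | U w E]]: ultrafilters make it a Boolean homomorphism, the second
    condition makes it blind to null sets, and the third makes it return a member of [B] up to a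
    null set, see [lifting_ae]. *)
Definition lifting_on B U :=
  [/\ forall w, UltraFilter (U w),
      forall w N, mu.-negligible N -> U w (~` N) &
      forall E, B E -> {ae mu, forall w, E w -> U w E}].

(** The last two conditions on a lifting survive enlarging the filters. Hence it suffices to
    construct proper filters, which the ultrafilter lemma completes at each point. *)
Lemma lifting_extend B (G : T -> set_system T) :
  (forall w, ProperFilter (G w)) ->
  (forall w N, mu.-negligible N -> G w (~` N)) ->
  (forall E, B E -> {ae mu, forall w, E w -> G w E}) ->
  exists2 U, lifting_on B U & forall w, G w `<=` U w.
Proof.
move=> GF GN GB.
pose U w := sval (cid (ultraFilterLemma (GF w))).
have UP w : UltraFilter (U w) /\ G w `<=` U w by rewrite /U; case: cid.
exists U => [|w]; last by case: (UP w).
split=> [w|w N N0|E /GB]; first by case: (UP w).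
- by apply: (UP w).2; exact: GN.
- by apply: filterS => w GE Ew; apply: (UP w).2; exact: GE.
Qed.

Section properties.
Variables (B : set (set T)) (U : T -> set_system T).
Hypotheses (Bs : sub_sigma B) (UB : lifting_on B U).

Lemma lifting_ultra w : UltraFilter (U w). Proof. by case: UB. Qed.

Lemma lifting_filter w : ProperFilter (U w).
Proof. exact: (@ultra_proper _ _ (lifting_ultra w)). Qed.

Lemma lifting_setC w E : U w E -> ~ U w (~` E).
Proof.
have UF := lifting_filter w.
by move=> UE /(filterI UE); rewrite setICr; exact: filter_not_empty.
Qed.

Lemma lifting_negl w N : mu.-negligible N -> ~ U w N.
Proof.
by move=> N0 /lifting_setC; apply; case: UB => _ + _; exact.
Qed.

Lemma lifting_le_negl w E H : mu.-negligible (E `\` H) -> U w E -> U w H.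
Proof.
have UF := lifting_filter w; case: UB => _ UN _ /(UN w) EH UE.
by apply: filterS (filterI UE EH) => x [Ex]; apply: contra_notP => Hx.
Qed.

(** The converse implication comes from the complement of [E], since no [U w] contains both sets. *)
Lemma lifting_ae E : B E -> {ae mu, forall w, E w <-> U w E}.
Proof.
move=> BE; case: UB => _ _ UE; have := UE _ (sub_sigmaC Bs BE).
have := UE _ BE; apply: filterS2 => w EU ECU; split=> // UwE.
by apply: contrapT => /ECU; exact: lifting_setC.
Qed.

End properties.

End liftings.

(** * Adjoining one measurable set to a lifting *)

Section finite_lifting.
Context {d : measure_display} {T : measurableType d} {R : realType}.
Variable mu : {finite_measure set T -> \bar R}.
Implicit Types (B : set (set T)) (C D E H N : set T) (U V : T -> set_system T).
Local Notation m E := (fine (mu E)).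

(** [H] is essentially the largest member of [B] with null trace on [E]: the place where the
    conditional probability of [E] given [B] vanishes. It is the intersection of the regions where
    this probability is at most [1/(n+1)]. *)
Lemma max_null B E : sub_sigma B -> measurable E ->
  exists H, [/\ B H, mu.-negligible (H `&` E) &
    forall C, B C -> mu.-negligible (C `&` E) -> mu.-negligible (C `\` H)].
Proof.
move=> Bs mE; have mEc := measurableC mE.
have mB C : B C -> measurable C by case: Bs => _; exact.
pose H n := sval (cid (sub_sigma_density mu n.+1%:R^-1 Bs mEc)).
have HP n : [/\ B (H n),
    forall C, B C -> C `<=` H n -> m (C `\` ~` E) <= n.+1%:R^-1 * m C &
    forall C, B C -> C `&` H n = set0 -> n.+1%:R^-1 * m C <= m (C `\` ~` E)].
  by rewrite /H; case: cid.
have BH n : B (H n) by case: (HP n).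
have BI : B (\bigcap_n H n) by exact: sub_sigma_bigcap.
exists (\bigcap_n H n); split => //.
  apply: fine_meas_eps_null; first by apply: measurableI => //; exact: mB.
  move=> e e0; set I := \bigcap_n H n.
  have IH n : m (I `&` E) <= n.+1%:R^-1 * m I.
    case: (HP n) => _ + _ => /(_ I BI).
    rewrite setDE setCK; apply; exact: bigcap_inf.
  pose n := Num.truncn (m I / e).
  have mIn : m I < n.+1%:R * e.
    by rewrite -ltr_pdivrMr// truncnS_gt.
  by rewrite (le_trans (IH n))// ler_pdivrMl ?ltW.
move=> C BC CE; rewrite setDE setC_bigcap setI_bigcupr.
apply: negligible_bigcup => n; rewrite -setDE.
have BCH : B (C `\` H n) by exact: sub_sigmaD.
have mCH := mB _ BCH.
(* Off [H n] a member of [B] meets [E] in at least the fraction [1/(n+1)] of its measure; as [C] has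
   null trace on [E], what remains of [C] off [H n] is null. *)
apply: fine_meas_null => //.
have := fine_meas_ge0 mu (C `\` H n); rewrite le_eqVlt => /orP[/eqP //|].
case: (HP n) => _ _ /(_ _ BCH).
have -> : (C `\` H n) `&` H n = set0 by rewrite setDE -setIA setICl setI0.
move=> /(_ erefl); rewrite (setDE _ (~` E)) setCK.
have -> : m ((C `\` H n) `&` E) = 0.
  rewrite (_ : mu _ = 0%E)//; apply/negligibleP; first exact: measurableI.
  by apply: negligibleS CE; apply: setSI; exact: subDsetl.
by rewrite pmulr_rle0 ?invr_gt0// => ? /lt_geF; lra.
Qed.

(* On [A] (resp. its complement) the old ultrafilter is refined by [A] itself,
   unless the old sigma-algebra sees the trace of [A] as null at [w]. *)
Lemma lifting_adjoin B U A : sub_sigma B -> lifting_on mu B U -> measurable A ->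
  exists B' U', [/\ sub_sigma B', lifting_on mu B' U', B `<=` B', B' A &
    forall w E, B E -> U w E -> U' w E].
Proof.
move=> Bs UB mA; have mB C : B C -> measurable C by case: Bs => _; exact.
(* The sets [mix E1 E2] with [E1] and [E2] in [B] form the sigma-algebra generated by [B] and
   [A]. *)
pose mix E1 E2 := (E1 `&` A) `|` (E2 `\` A).
pose B' := [set E | exists E1 E2, [/\ B E1, B E2 & E = mix E1 E2]].
have mixC E1 E2 : ~` mix E1 E2 = mix (~` E1) (~` E2).
  rewrite predeqE => x; rewrite /mix/=; case: (pselect (A x)) => Ax; tauto.
have [B0 BC BU] : sigma_algebra setT B by case: Bs.
have B's : sub_sigma B'.
  split; last first.
    move=> E [E1 [E2 [BE1 BE2 ->]]]; apply: measurableU.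
      by apply: measurableI => //; exact: mB.
    by apply: measurableD => //; exact: mB.
  split.
  - by exists set0, set0; split => //; rewrite /mix set0I set0D setU0.
  - move=> E [E1 [E2 [BE1 BE2 ->]]]; exists (~` E1), (~` E2).
    by split; [exact: sub_sigmaC|exact: sub_sigmaC|rewrite setTD mixC].
  - move=> E BE; pose E1 n := sval (cid (BE n)).
    pose E2 n := sval (cid (svalP (cid (BE n)))).
    have EP n : [/\ B (E1 n), B (E2 n) & E n = mix (E1 n) (E2 n)].
      exact: (svalP (cid (svalP (cid (BE n))))).
    exists (\bigcup_n E1 n), (\bigcup_n E2 n); split.
    + by apply: BU => n; case: (EP n).
    + by apply: BU => n; case: (EP n).
    + rewrite predeqE => x; split.
        move=> [n _]; case: (EP n) => _ _ ->.
        by case=> -[En xA]; [left|right]; split=> //; exists n.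
      by case=> -[[n _ En] xA]; exists n => //; case: (EP n) => _ _ ->;
        [left|right].
have BB' : B `<=` B'.
  move=> E BE; exists E, E; split=> //.
  by rewrite /mix setDE -setIUr setUv setIT.
have [H [BH HA Hmax]] := max_null Bs mA.
have [H' [BH' HA' Hmax']] := max_null Bs (measurableC mA).
pose X w := [set x | (A w -> ~ U w H -> A x) /\ (~ A w -> ~ U w H' -> ~ A x)].
(* The filter generated by the members of [B] in [U w], by [X w] and by the conull sets. *)
pose G w := [set E | exists2 E1, B E1 /\ U w E1 & mu.-negligible ((E1 `&` X w) `\` E)].
have GF w : ProperFilter (G w).
  have UF := lifting_filter UB w.
  split.
    move=> [E1 [BE1 UE1]]; rewrite setD0 => E1X.
    (* If a member [E1] of [B] in [U w] had null trace on [X w], maximality of [H] and [H'] would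
       put the relevant one into [U w]. Then [X w] is the whole space, so [E1] itself is null, which
       is impossible. *)
    have nH : (A w -> U w H) /\ (~ A w -> U w H').
      split=> Aw; apply: contrapT => nUH; apply: (nUH).
        apply: (lifting_le_negl UB _ UE1); apply: Hmax => //.
        by apply: negligibleS E1X; apply: setIS => x Ax; split.
      apply: (lifting_le_negl UB _ UE1); apply: Hmax' => //.
      by apply: negligibleS E1X; apply: setIS => x Ax; split.
    apply: (lifting_negl UB _ UE1); apply: negligibleS E1X => x E1x.
    by split=> //; split=> [/(nH.1)|/(nH.2)].
  split.
  - exists setT; first by split; [exact: sub_sigmaT|exact: filterT].
    by rewrite setDT; exact: negligible_set0.
  - move=> E E' [E1 [BE1 UE1] E1N] [E2 [BE2 UE2] E2N].
    exists (E1 `&` E2); first by split; [exact: sub_sigmaI|exact: filterI].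
    apply: negligibleS (negligibleU E1N E2N) => x [[[E1x E2x] Xx]].
    by move=> /not_andP[nE|nE]; [left|right].
  - move=> E E' EE' [E1 E1P E1N]; exists E1 => //.
    by apply: negligibleS E1N => x [? nE']; split=> // /EE'.
have GN w N : mu.-negligible N -> G w (~` N).
  move=> N0; exists setT; last by apply: negligibleS N0 => x [_]/contrapT.
  by have UF := lifting_filter UB w; split; [exact: sub_sigmaT|exact: filterT].
have GB E : B' E -> {ae mu, forall w, E w -> G w E}.
  move=> [E1 [E2 [BE1 BE2 ->]]].
  near=> w.
  have UFw := lifting_filter UB w.
  have E1w : E1 w <-> U w E1 by near: w; exact: lifting_ae BE1.
  have E2w : E2 w <-> U w E2 by near: w; exact: lifting_ae BE2.
  have Hw : H w <-> U w H by near: w; exact: lifting_ae BH.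
  have H'w : H' w <-> U w H' by near: w; exact: lifting_ae BH'.
  (* Almost every point of [A] avoids [H], and almost every point of the complement avoids [H'];
     there the exceptional case of [X w] does not occur and [X w] stays on the side of [w]. *)
  have HAw : ~ (H `&` A) w.
    by near: w; apply: negligibleS HA => x /=/contrapT.
  have HA'w : ~ (H' `&` ~` A) w.
    by near: w; apply: negligibleS HA' => x /=/contrapT.
  case=> -[Ew Aw].
    exists E1; first by split=> //; exact/E1w.
    apply: negligibleS (negligible_set0 mu) => x [[E1x Xx]] []; left; split=> //.
    by apply: Xx.1 => // /Hw Hw'; apply: HAw.
  exists E2; first by split=> //; exact/E2w.
  apply: negligibleS (negligible_set0 mu) => x [[E2x Xx]] []; right; split=> //.
  by apply: Xx.2 => // /H'w Hw'; apply: HA'w.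
have [U' U'B' GU'] := lifting_extend GF GN GB.
exists B', U'; split=> //.
  exists setT, set0; split; first exact: sub_sigmaT Bs.
    by [].
  by rewrite /mix setTI set0D setU0.
move=> w E BE UE; apply: GU'; exists E => //.
by apply: negligibleS (negligible_set0 mu) => x [[]].
Unshelve. all: by end_near. Qed.

End finite_lifting.

(** * Limits of increasing sequences of liftings *)

Section lifting_limit.
Context {d : measure_display} {T : measurableType d} {R : realType}.
Variable mu : {finite_measure set T -> \bar R}.
Implicit Types (C D E H N : set T).
Local Notation m E := (fine (mu E)).

Lemma fine_meas_bigcup_le (F : nat -> set T) (c : R) :
  (forall n, measurable (F n)) -> nondecreasing_seq F ->
  (forall n, m (F n) <= c) -> m (\bigcup_n F n) <= c.
Proof.
move=> mF ndF Fc; have mUF := bigcupT_measurable F mF.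
rewrite -lee_fin fineK ?fin_num_measure//.
have FU := nondecreasing_cvg_mu (mu := mu) mF mUF ndF.
rewrite -(cvg_lim (@ereal_hausdorff R) FU); apply: lime_le.
  by apply/cvg_ex; eexists; exact: FU.
by apply: nearW => n /=; rewrite -[mu _]fineK ?lee_fin ?fin_num_measure.
Qed.

Variables (B : nat -> set (set T)) (U : nat -> T -> set_system T).
Hypothesis Bs : forall n, sub_sigma (B n).
Hypothesis UB : forall n, lifting_on mu (B n) (U n).
Hypothesis BB : forall n, B n `<=` B n.+1.
Hypothesis UU : forall n w E, B n E -> U n w E -> U n.+1 w E.

Let B_le n p : (n <= p)%N -> B n `<=` B p.
Proof.
move=> /subnK <-; elim: (p - n)%N => // q IH E /IH; rewrite addSn; exact: BB.
Qed.

Let U_le n p w E : (n <= p)%N -> B n E -> U n w E -> U p w E.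
Proof.
move=> /subnK <-; elim: (p - n)%N => // q IH BE UE; rewrite addSn.
by apply: UU; [apply: B_le BE; rewrite leq_addl|exact: IH].
Qed.

Let mB n E : B n E -> measurable E.
Proof. exact: sub_sigma_measurable (Bs n). Qed.

Let Boo := <<s \bigcup_n B n >>.

Let Boo_sub : sub_sigma Boo.
Proof.
split; first exact: smallest_sigma_algebra.
apply: smallest_sub; first exact: sigma_algebra_measurable.
by move=> E [n _]; exact: mB.
Qed.

Let approximable E := measurable E /\ forall e : R, 0 < e -> exists n E',
  [/\ B n E', m (E `\` E') <= e & m (E' `\` E) <= e].

Let approximableU E H : approximable E -> approximable H -> approximable (E `|` H).
Proof.
move=> [mE aE] [mH aH]; split; first exact: measurableU.
move=> e e0; have e20 : 0 < e / 2 by rewrite divr_gt0.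
have [n [E' [BE' E1 E2]]] := aE _ e20; have [p [H' [BH' H1 H2]]] := aH _ e20.
have mE' := mB BE'; have mH' := mB BH'.
exists (maxn n p), (E' `|` H'); split.
- apply: sub_sigmaU => //; [apply: B_le BE'|apply: B_le BH'].
    exact: leq_maxl.
  exact: leq_maxr.
- apply: (@le_trans _ _ (m ((E `\` E') `|` (H `\` H')))).
    apply: fine_meas_le.
    - by apply: measurableD; exact: measurableU.
    - by apply: measurableU; exact: measurableD.
    - by move=> x [[Ex|Hx]] /not_orP[nE nH]; [left|right].
  rewrite (le_trans (fine_meas_U _ _ _)) //; [exact: measurableD..|lra].
- apply: (@le_trans _ _ (m ((E' `\` E) `|` (H' `\` H)))).
    apply: fine_meas_le.
    - by apply: measurableD; exact: measurableU.
    - by apply: measurableU; exact: measurableD.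
    - by move=> x [[Ex|Hx]] /not_orP[nE nH]; [left|right].
  rewrite (le_trans (fine_meas_U _ _ _)) //; [exact: measurableD..|lra].
Qed.

(** The sets that can be approximated in measure by members of the [B n] form a sigma-algebra
    containing every [B n]. For a countable union, a finite subunion losing at most [e / 2] is
    approximated instead. *)
Lemma sub_sigma_approximation E (e : R) : Boo E -> 0 < e -> exists n E',
  [/\ B n E', m (E `\` E') <= e & m (E' `\` E) <= e].
Proof.
move=> BE; suff : approximable E by move=> [_]; exact.
clear e; move: E BE; apply: smallest_sub; last first.
  move=> E [n _ BE]; split; first exact: mB BE.
  by move=> e e0; exists n, E; rewrite setDv measure0/= ltW.
have a0 : approximable set0.
  split=> // e e0; exists 0%N, set0; rewrite setDv measure0/= ltW//.
  by split=> //; exact: sub_sigma0.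
split=> //.
  move=> E [mE aE]; rewrite setTD; split; first exact: measurableC.
  move=> e /aE[n [E' [BE' E1 E2]]]; exists n, (~` E').
  by rewrite !setDE !setCK !(setIC (~` _)) -!setDE; split=> //; exact: sub_sigmaC.
move=> E aE; have mE n : measurable (E n) by case: (aE n).
have mUE : measurable (\bigcup_n E n) by exact: bigcupT_measurable.
split=> // e e0; have e20 : 0 < e / 2 by rewrite divr_gt0.
pose F n := \big[setU/set0]_(i < n) E i.
have aF n : approximable (F n).
  rewrite /F; elim: n => [|n IH]; first by rewrite big_ord0.
  by rewrite big_ord_recr/=; exact: approximableU.
have mF n : measurable (F n) by case: (aF n).
have FE n : F n `<=` \bigcup_n E n.
  by rewrite /F -bigcup_mkord; apply: bigcup_sub => i _; exact: bigcup_sup.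
have [n Fn] : exists n, m (\bigcup_n E n) - e / 2 < m (F n).
  apply: contrapT => /forallNP Fe.
  have : m (\bigcup_n F n) <= m (\bigcup_n E n) - e / 2.
    apply: fine_meas_bigcup_le => //.
      by move=> i j ij; apply/subsetPset; exact: subset_bigsetU.
    by move=> n; rewrite leNgt; apply/negP.
  have -> : \bigcup_n F n = \bigcup_n E n.
    apply/seteqP; split; first by apply: bigcup_sub.
    by rewrite -bigcup_bigsetU_bigcup => x [n _ Fx]; exists n.+1.
  lra.
have [p [E' [BE' E1 E2]]] := (aF n).2 _ e20.
have mE' := mB BE'.
exists p, E'; split=> //.
  apply: (@le_trans _ _ (m ((\bigcup_n E n `\` F n) `|` (F n `\` E')))).
    apply: fine_meas_le; first exact: measurableD.
      by apply: measurableU; exact: measurableD.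
    by move=> x [Ex E'x]; case: (pselect (F n x)) => Fx; [right|left].
  rewrite (le_trans (fine_meas_U _ _ _)) //; [exact: measurableD..|].
  have := fine_meas_split mu mUE (mF n); rewrite (setIidr (FE n)); lra.
apply: (le_trans _ (le_trans E2 _)); last lra.
apply: fine_meas_le; [exact: measurableD..|].
by apply: setDS; exact: FE.
Qed.

(** The maximal inequality. Points of a good approximation [E'] of [E] are sorted by the first index
    at which they leave [H]. Each layer is seen by the sigma-algebra of that index, so it has at
    least the fraction [s] of its measure outside [E]; since [E'] has little measure outside [E],
    few points ever leave. *)
Let exit_null E (s : R) (H : nat -> set T) : Boo E -> 0 < s ->
  (forall n, B n (H n)) ->
  (forall n C, B n C -> C `&` H n = set0 -> s * m C <= m (C `\` E)) ->
  mu.-negligible (E `&` \bigcap_n \bigcup_p ~` H (n + p)%N).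
Proof.
move=> BE s0 BH HC; have mE := sub_sigma_measurable Boo_sub BE.
have mH n : measurable (H n) by exact: mB (BH n).
have mU n : measurable (\bigcup_p ~` H (n + p)%N).
  by apply: bigcupT_measurable => p; exact: measurableC.
have mZ : measurable (E `&` \bigcap_n \bigcup_p ~` H (n + p)%N).
  by apply: measurableI => //; exact: bigcapT_measurable.
apply: fine_meas_eps_null => // e e0.
(* With [e' = e / (1 + s^-1)], the approximation error [e'] and the maximal bound [e' / s] add up to
   [e]. *)
have e'0 : 0 < e / (1 + s^-1) by rewrite divr_gt0// addr_gt0// invr_gt0.
have [N [E' [BE' E1 E2]]] := sub_sigma_approximation BE e'0.
have mE' := mB BE'.
pose V n := E' `&` \big[setU/set0]_(p < n) ~` H (N + p)%N.
have BV n : B (N + n)%N (V n).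
  apply: sub_sigmaI => //; first by apply: B_le BE'; exact: leq_addr.
  elim: n => [|n IH]; first by rewrite big_ord0; exact: sub_sigma0.
  rewrite big_ord_recr/=; apply: sub_sigmaU => //.
    by apply: B_le IH; rewrite leq_add2l.
  by apply: sub_sigmaC => //; apply: B_le (BH _); rewrite leq_add2l.
have mV n : measurable (V n) by exact: mB (BV n).
have VE n : s * m (V n) <= m (V n `\` E).
  elim: n => [|n IH]; first by rewrite /V big_ord0 setI0 set0D measure0/= mulr0.
  (* The layer of the points of [E'] whose first exit after [N] happens at [N + n]. *)
  pose W := (E' `\` H (N + n)%N) `\` V n.
  have BW : B (N + n)%N W.
    apply: sub_sigmaD => //; apply: sub_sigmaD => //.
    by apply: B_le BE'; exact: leq_addr.
  have mW := mB BW.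
  have WE : s * m W <= m (W `\` E).
    by apply: (HC (N + n)%N) => //; rewrite -subset0 => x [[[_ ?]]].
  have VW : V n.+1 `\` V n = W.
    rewrite /V big_ord_recr/= /W; apply/seteqP; split=> x.
      move=> [[Ex [Ux|Hx]] nV]; last by split.
      by exfalso; apply: nV.
    by move=> [[Ex Hx] nV]; split=> //; split=> //; right.
  have VV : V n.+1 `&` V n = V n.
    apply/seteqP; split=> [x []//|x [Ex Ux]]; split=> //; split=> //.
    by rewrite big_ord_recr; left.
  have := fine_meas_split mu (mV n.+1) (mV n); rewrite VW VV => ->.
  have := fine_meas_split mu (measurableD (mV n.+1) mE) (mV n).
  rewrite (_ : (V n.+1 `\` E) `&` V n = V n `\` E); last first.
    by rewrite -{2}VV !setDE (setIAC (V n.+1)).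
  rewrite (_ : (V n.+1 `\` E) `\` V n = W `\` E); last first.
    by rewrite -VW !setDE (setIAC (V n.+1)).
  rewrite mulrDr; lra.
have Vs n : m (V n) <= e / (1 + s^-1) / s.
  rewrite ler_pdivlMr// mulrC (le_trans (VE n))// (le_trans _ E2)//.
  by apply: fine_meas_le; [exact: measurableD|exact: measurableD|apply: setSD => x []].
have mUV : measurable (\bigcup_n V n) := bigcupT_measurable V mV.
have VUs : m (\bigcup_n V n) <= e / (1 + s^-1) / s.
  apply: fine_meas_bigcup_le => // i j ij; apply/subsetPset.
  move=> x [E'x Ux]; split=> //.
  exact: (@subset_bigsetU _ (fun p => ~` H (N + p)%N) _ _ ij).
apply: (@le_trans _ _ (m ((E `\` E') `|` \bigcup_n V n))).
  apply: fine_meas_le => //; first by apply: measurableU => //; exact: measurableD.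
  move=> x [Ex] /(_ N I)[p _ Hx]; case: (pselect (E' x)) => E'x; [right|left] => //.
  by exists p.+1 => //; split=> //; rewrite big_ord_recr; right.
rewrite (le_trans (fine_meas_U _ _ _)) //; first exact: measurableD.
apply: (le_trans (lerD E1 VUs)).
rewrite -[X in X + _]mulr1 -mulrDr divfK// gt_eqF// addr_gt0// invr_gt0//.
Qed.

(* A set belongs to the limit ultrafilter at [w] as soon as its relative measure
   near [w], as seen by the [n]-th sigma-algebra, tends to 1.  By a maximal
   inequality (Lebesgue's density theorem for martingales) this holds at almost
   every point of the set. *)
Lemma lifting_limit : exists B' U', [/\ sub_sigma B', lifting_on mu B' U',
  forall n, B n `<=` B' & forall n w E, B n E -> U n w E -> U' w E].
Proof.
(* Passing to a measurable [E'] inside [E] makes [G w] closed under arbitrary supersets. *)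
pose G w := [set E | exists E', [/\ measurable E', E' `<=` E &
  forall s : R, 0 < s -> exists k, forall n : nat, (k <= n)%N -> exists H,
    [/\ B n H, U n w H & forall C, B n C -> C `<=` H -> m (C `\` E') <= s * m C]]].
have GF w : ProperFilter (G w).
  split.
    (* With [E'] empty, [s = 1/2] and [C := H] give [m H <= m H / 2], so [H] is null and cannot
       belong to an ultrafilter of a lifting. *)
    move=> [E' [_ E'0 /(_ 2^-1)]].
    rewrite invr_gt0 ltr0n => /(_ isT)[N /(_ N (leqnn _))[H [BH UH /(_ H BH)]]].
    move=> /(_ (fun _ => id)).
    have -> : E' = set0 by apply/seteqP; split.
    rewrite setD0 => H0; apply: (lifting_negl (UB N) _ UH).
    apply: fine_meas_null; first exact: mB BH.
    have := fine_meas_ge0 mu H; lra.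
  split.
  - exists setT; split=> // s s0; exists 0%N => n _; exists setT; split.
    + exact: sub_sigmaT.
    + have UF := lifting_filter (UB n) w; exact: filterT.
    + by move=> C _ _; rewrite setDT measure0/= mulr_ge0 ?fine_meas_ge0 ?ltW.
  - move=> E F [E' [mE' EE' E's]] [F' [mF' FF' F's]].
    exists (E' `&` F'); split; [exact: measurableI|exact: setISS|] => s s0.
    have s20 : 0 < s / 2 by rewrite divr_gt0.
    have [N NP] := E's _ s20; have [N' NP'] := F's _ s20.
    exists (maxn N N') => n; rewrite geq_max => /andP[/NP + /NP'].
    move=> [H [BH UH HC]] [H' [BH' UH' HC']]; exists (H `&` H'); split.
    + exact: sub_sigmaI.
    + have UF := lifting_filter (UB n) w; exact: filterI.
    + move=> C BC; rewrite subsetI => -[/(HC _ BC) C1 /(HC' _ BC) C2].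
      have mC := mB BC; rewrite setDIr (le_trans (fine_meas_U _ _ _)) //.
      * exact: measurableD.
      * exact: measurableD.
      * lra.
  - move=> E F EF [E' [mE' EE' E's]]; exists E'; split=> //.
    exact: subset_trans EF.
have GN w N : mu.-negligible N -> G w (~` N).
  move=> [M [mM M0 NM]]; exists (~` M); split; first exact: measurableC.
    exact: subsetC.
  move=> s s0; exists 0%N => n _; exists setT; split.
  - exact: sub_sigmaT.
  - have UF := lifting_filter (UB n) w; exact: filterT.
  - move=> C BC _; rewrite setDE setCK (_ : m _ = 0).
      by rewrite mulr_ge0 ?fine_meas_ge0 ?ltW.
    rewrite (_ : mu _ = 0%E)//; have mC := mB BC.
    apply/negligibleP; first exact: measurableI.
    by exists M; split=> // x [].
have GB n w E : B n E -> U n w E -> G w E.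
  move=> BE UE; exists E; split=> //; first exact: mB BE.
  move=> s s0; exists n => p np; exists E; split.
  - exact: B_le BE.
  - exact: U_le UE.
  - by move=> C _; rewrite -setD_eq0 => ->; rewrite measure0/= mulr_ge0 ?fine_meas_ge0 ?ltW.
have GE E : Boo E -> {ae mu, forall w, E w -> G w E}.
  move=> BE; have mE := sub_sigma_measurable Boo_sub BE.
  pose H k n := sval (cid (sub_sigma_density mu k.+1%:R^-1 (Bs n) mE)).
  have HP k n : [/\ B n (H k n),
      forall C, B n C -> C `<=` H k n -> m (C `\` E) <= k.+1%:R^-1 * m C &
      forall C, B n C -> C `&` H k n = set0 -> k.+1%:R^-1 * m C <= m (C `\` E)].
    by rewrite /H; case: cid.
  (* For every level [1/(k+1)], almost every point of [E] lies in [H k n] for all large [n]. *)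
  have : {ae mu, forall w, forall k,
      ~ (E `&` \bigcap_n \bigcup_p ~` H k (n + p)%N) w}.
    apply: ae_foralln => k.
    have : mu.-negligible (E `&` \bigcap_n \bigcup_p ~` H k (n + p)%N).
      by apply: (exit_null BE (s := k.+1%:R^-1)) => // n; case: (HP k n).
    by apply: negligibleS => w /=/contrapT.
  have : {ae mu, forall w, forall k n, H k n w <-> U n w (H k n)}.
    apply: ae_foralln => k; apply: ae_foralln => n.
    by apply: (lifting_ae (Bs n) (UB n)); case: (HP k n).
  apply: filterS2 => w HU Hex Ew; exists E; split=> // s s0.
  pose k := Num.truncn s^-1.
  have ks : k.+1%:R^-1 <= s.
    by rewrite invf_ple ?posrE// ltW// truncnS_gt.
  have := Hex k; move=> /not_andP[//|/existsNP[N /not_implyP[_ NH]]].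
  exists N => n Nn; exists (H k n); case: (HP k n) => BH HC _; split=> //.
    apply/HU; apply: contrapT => nH; apply: NH; exists (n - N)%N => //=.
    by rewrite subnKC.
  move=> C BC CH; rewrite (le_trans (HC C BC CH))// ler_wpM2r//.
  exact: fine_meas_ge0.
have [U' U'B GU'] := lifting_extend GF GN GE.
exists Boo, U'; split=> //; last by move=> n w E BE UE; apply: GU'; exact: GB UE.
by move=> n E BE; apply: sub_sigma_algebra; exists n.
Qed.

End lifting_limit.

(** * Existence of liftings by Zorn's lemma *)

Section finite_lifting_existence.
Context {d : measure_display} {T : measurableType d} {R : realType}.
Variable mu : {finite_measure set T -> \bar R}.
Hypothesis mu_gt0 : (0 < mu [set: T])%E.

Let pre_lifting := {p : set (set T) * (T -> set_system T) |
  sub_sigma p.1 /\ lifting_on mu p.1 p.2}.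

(** The ultrafilters are compared on the smaller sigma-algebra only; they may disagree on other
    sets. *)
Let le (p q : pre_lifting) : bool := `[< (sval p).1 `<=` (sval q).1 /\
  forall w E, (sval p).1 E -> (sval p).2 w E -> (sval q).2 w E >].

Let le_refl p : le p p. Proof. by apply/asboolP; split. Qed.

Let le_trans p q r : le p q -> le q r -> le p r.
Proof.
move=> /asboolP[pq1 pq2] /asboolP[qr1 qr2]; apply/asboolP; split.
  exact: subset_trans qr1.
by move=> w E pE pU; apply: qr2; [exact: pq1|exact: pq2].
Qed.

(** On the trivial sigma-algebra any ultrafilters refining the almost everywhere filter will do;
    that filter is proper because [mu] is nonzero. *)
Let trivial_lifting : exists p : pre_lifting, True.
Proof.
have [||E|U UB _] := @lifting_extend _ _ _ mu [set set0; setT] (fun=> almost_everywhere mu).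
- by move=> w; exact: ae_properfilter_algebraOfSetsType.
- by move=> w N N0; rewrite /almost_everywhere; apply: negligibleS N0 => x /=/contrapT.
- case=> ->; first exact: aeW.
  by apply: aeW => w _; rewrite /almost_everywhere setCT; exact: negligible_set0.
suff Bs : sub_sigma [set set0; [set: T]] by exists (exist _ (_, _) (conj Bs UB)).
split; last by move=> _ [->|->].
split; first by left.
- by move=> _ [->|->]; rewrite setTD ?setC0 ?setCT; [right|left].
- move=> E Eb; case: (pselect (exists n, E n = setT)) => [[n EnT]|EnT].
    by right; apply/seteqP; split=> // x _; exists n => //; rewrite EnT.
  left; apply/seteqP; split=> // x [n _].
  by case: (Eb n) => [->//|EnT']; exfalso; apply: EnT; exists n.
Qed.

(** The running maxima [e n] of the sequence increase and dominate it, so [lifting_limit] applies to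
    them. *)
Let bound_countable (c : nat -> pre_lifting) :
  (forall n p, le (c n) (c p) \/ le (c p) (c n)) ->
  exists q, forall n, le (c n) q.
Proof.
move=> ctot.
pose e n := iteri n (fun n p => if le (c n.+1) p then p else c n.+1) (c 0%N).
have eS n : e n.+1 = if le (c n.+1) (e n) then e n else c n.+1 by [].
have ec n : exists p, e n = c p.
  elim: n => [|n [p ep]]; first by exists 0%N.
  by rewrite eS; case: ifP => _; [exists p|exists n.+1].
have ee n : le (e n) (e n.+1).
  rewrite eS; case: ifPn => //; have [p ->] := ec n.
  by case: (ctot n.+1 p) => ->.
have ce n : le (c n) (e n).
  by case: n => [//|n]; rewrite eS; case: ifPn.
have [||||B' [U' [B's U'B BB UU]]] := @lifting_limit _ _ _ mu
    (fun n => (sval (e n)).1) (fun n => (sval (e n)).2).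
- by move=> n; case: (svalP (e n)).
- by move=> n; case: (svalP (e n)).
- by move=> n; have /asboolP[] := ee n.
- by move=> n; have /asboolP[_] := ee n.
exists (exist _ (B', U') (conj B's U'B)) => n; apply: (le_trans (ce n)).
by apply/asboolP; split; [exact: BB|exact: UU].
Qed.

(** When every sequence of the chain is bounded inside the chain, the union of the sigma-algebras is
    closed under countable unions, and the filters can be merged directly. *)
Let bound_uncountable (A : set pre_lifting) : A !=set0 -> total_on A le ->
  (forall c : nat -> pre_lifting, (forall n, A (c n)) ->
     exists2 q, A q & forall n, le (c n) q) ->
  exists q, forall p, A p -> le p q.
Proof.
move=> [p0 Ap0] Atot Ac.
pose B := \bigcup_(p in A) (sval p).1.
have Bs : sub_sigma B.
  split; last by move=> E [p _ pE]; exact: sub_sigma_measurable (svalP p).1 pE.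
  split.
  - by exists p0 => //; apply: sub_sigma0; case: (svalP p0).
  - by move=> E [p Ap pE]; rewrite setTD; exists p => //; apply: sub_sigmaC pE; case: (svalP p).
  - move=> E BE; pose c n := s2val (cid2 (BE n)).
    have [|q Aq cq] := Ac c; first by move=> n; exact: (s2valP (cid2 (BE n))).
    exists q => //; apply: sub_sigma_bigcup; first by case: (svalP q).
    move=> n; have /asboolP[+ _] := cq n; apply.
    exact: (s2valP' (cid2 (BE n))).
pose G w := [set E | exists p, A p /\ exists E1,
  [/\ (sval p).1 E1, (sval p).2 w E1 & mu.-negligible (E1 `\` E)]].
have GF w : ProperFilter (G w).
  split.
    move=> [p [Ap [E1 [pE UE]]]]; rewrite setD0.
    by move/(lifting_negl (svalP p).2); apply; exact: UE.
  split.
  - exists p0; split=> //; exists setT; split.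
    + by apply: sub_sigmaT; case: (svalP p0).
    + by have UF := lifting_filter (svalP p0).2 w; exact: filterT.
    + by rewrite setDv; exact: negligible_set0.
  - have GI p q E F E1 F1 : le p q -> A q ->
        (sval p).1 E1 -> (sval p).2 w E1 -> mu.-negligible (E1 `\` E) ->
        (sval q).1 F1 -> (sval q).2 w F1 -> mu.-negligible (F1 `\` F) ->
        G w (E `&` F).
      move=> /asboolP[pq1 pq2] Aq pE1 UE1 E1E qF1 UF1 F1F.
      exists q; split=> //; exists (E1 `&` F1); split.
      + by apply: sub_sigmaI; [case: (svalP q)|exact: pq1|].
      + have UF := lifting_filter (svalP q).2 w; apply: filterI => //.
        exact: pq2.
      + apply: negligibleS (negligibleU E1E F1F) => x [[E1x F1x]].
        by move=> /not_andP[nE|nF]; [left|right].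
    move=> E F [p [Ap [E1 [pE1 UE1 E1E]]]] [q [Aq [F1 [qF1 UF1 F1F]]]].
    have [pq|qp] := Atot _ _ Ap Aq; first exact: GI pq _ _ _ E1E _ _ F1F.
    by rewrite setIC; apply: GI qp _ _ _ F1F _ _ E1E.
  - move=> E F EF [p [Ap [E1 [pE1 UE1 E1E]]]]; exists p; split=> //.
    by exists E1; split=> //; apply: negligibleS E1E; exact: setDS.
have GN w N : mu.-negligible N -> G w (~` N).
  move=> N0; exists p0; split=> //; exists setT; split.
  - by apply: sub_sigmaT; case: (svalP p0).
  - by have UF := lifting_filter (svalP p0).2 w; exact: filterT.
  - by rewrite setTD setCK.
have GA p w E : A p -> (sval p).1 E -> (sval p).2 w E -> G w E.
  move=> Ap pE UE; exists p; split=> //; exists E; split=> //.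
  by rewrite setDv; exact: negligible_set0.
have GB E : B E -> {ae mu, forall w, E w -> G w E}.
  move=> [p Ap pE]; have := lifting_ae (svalP p).1 (svalP p).2 pE.
  by apply: filterS => w EU /EU; exact: GA.
have [U UB GU] := lifting_extend GF GN GB.
exists (exist _ (B, U) (conj Bs UB)) => p Ap; apply/asboolP; split.
  by move=> E pE; exists p.
by move=> w E pE UE; apply: GU; exact: GA UE.
Qed.

Lemma finite_lifting : exists U, lifting_on mu measurable U.
Proof.
have [p0 _] := trivial_lifting.
have [A Atot|p pmax] := ZL_preorder p0 le_refl le_trans; last first.
  exists (sval p).2; have [ps pU] := svalP p.
  suff <- : (sval p).1 = measurable by [].
  apply/seteqP; split; first by case: ps.
  move=> E mE; have [B' [U' [B's U'B BB' B'E UU']]] := lifting_adjoin ps pU mE.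
  pose q : pre_lifting := exist _ (B', U') (conj B's U'B).
  have /pmax/asboolP[+ _] : le p q by apply/asboolP; split.
  exact.
have [A0|] := pselect (A !=set0); last by move=> /set0P/negP/negPn/eqP ->; exists p0.
have [Ac|] := pselect (forall c : nat -> pre_lifting, (forall n, A (c n)) ->
     exists2 q, A q & forall n, le (c n) q); first exact: bound_uncountable.
move=> /existsNP[c /not_implyP[Ac cub]].
have [|q cq] := @bound_countable c; first by move=> n p; exact: Atot.
exists q => p Ap.
(* By totality, a sequence with no upper bound in the chain is cofinal in it. *)
have [n pn] : exists n, le p (c n).
  apply: contrapT => /forallNP np; apply: cub; exists p => // n.
  by case: (Atot _ _ Ap (Ac n)) => // /np.
exact: le_trans (cq n).
Qed.

End finite_lifting_existence.

(** * Liftings of localizable measures *)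

Section localizable.
Context {d : measure_display} {T : measurableType d} {R : realType}.
Variable mu : {measure set T -> \bar R}.
Hypothesis mu_complete : measure_is_complete mu.
Variables (I : choiceType) (A : I -> set T).
Hypothesis A_cover : \bigcup_i A i = [set: T].
Hypothesis A_triv : trivIset [set: I] A.
Hypothesis A_fin : forall i, measurable (A i) /\ (mu (A i) < +oo)%E.
Hypothesis A_meas : forall B : set T, measurable B <-> forall i, measurable (B `&` A i).
Hypothesis A_mu : forall B : set T, measurable B ->
  mu B = \esum_(i in [set: I]) mu (B `&` A i).

(** There may be uncountably many pieces. Completeness makes every trace of [N] measurable, hence
    [N] is measurable by localizability, and its measure is a sum of zeros. *)
Lemma localizable_negligible (N : set T) :
  (forall i, mu.-negligible (N `&` A i)) -> mu.-negligible N.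
Proof.
move=> NA.
have mN : measurable N by apply/A_meas => i; exact: mu_complete.
apply/negligibleP => //; apply: (etrans (A_mu mN)); rewrite esum1// => i _.
by apply: measure_negligible => //; exact: mu_complete.
Qed.

Lemma localizable_ae (P : T -> Prop) :
  (forall i, {ae mu, forall w, A i w -> P w}) -> {ae mu, forall w, P w}.
Proof.
move=> PA; apply: localizable_negligible => i.
by apply: negligibleS (PA i) => w [nP Aw] /(_ Aw).
Qed.

Lemma piece_index w : exists i, A i w.
Proof. by have : setT w by []; rewrite -A_cover => -[i _ Aiw]; exists i. Qed.

Lemma piece_index_uniq i j w : A i w -> A j w -> i = j.
Proof. by move=> Ai Aj; apply: A_triv => //; exists w. Qed.

(** Comes from the finite measure [mu] restricted to [A i], whose null sets include those of
    [mu]. *)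
Lemma piece_lifting i : (0 < mu (A i))%E -> exists U : T -> set_system T,
  [/\ forall w, UltraFilter (U w),
      forall w N, mu.-negligible N -> U w (~` N) &
      forall E, measurable E -> {ae mu, forall w, A i w -> E w -> U w E}].
Proof.
move=> Ai0; have [mA Aoo] := A_fin i.
have [|U [UF UN UE]] := @finite_lifting _ _ _ (mfrestr mA Aoo).
  by rewrite /= /mfrestr /mrestr setTI.
exists U; split=> //.
  move=> w N [M [mM M0 NM]]; apply: UN; exists M; split=> //.
  rewrite /mfrestr /mrestr; apply: subset_measure0 M0 => //.
  exact: measurableI.
move=> E /UE[M [mM M0 NM]]; exists (M `&` A i); split => //.
  exact: measurableI.
by move=> w /= /not_implyP[Aw nE]; split=> //; exact: NM.
Qed.

(** Each point takes the ultrafilter given by the lifting of its own piece. *)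
Lemma localizable_lifting : (0 < mu [set: T])%E ->
  exists U, lifting_on mu measurable U.
Proof.
move=> mu0.
have [i0 i00] : exists i, (0 < mu (A i))%E.
  apply: contrapT => /forallNP A0; move: mu0; rewrite A_mu// esum1 ?ltxx// => i _.
  by rewrite setTI; apply/eqP; rewrite -measure_le0 leNgt; exact/negP/A0.
have VP i : exists U : T -> set_system T,
  [/\ forall w, UltraFilter (U w),
      forall w N, mu.-negligible N -> U w (~` N) &
      forall E, measurable E -> {ae mu, forall w, A i w -> E w -> U w E}].
  have [Ai0|Ai0] := pselect ((0 < mu (A i))%E); first exact: piece_lifting.
  (* On a null piece the last condition is void, so the ultrafilters of a fixed piece of positive
     measure are borrowed. *)
  have [U [UF UN _]] := piece_lifting i00; exists U; split=> // E mE.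
  exists (A i); split=> //; first by case: (A_fin i).
    by apply/eqP; rewrite -measure_le0 leNgt; exact/negP.
  by move=> w /= /not_implyP[].
pose V i := sval (cid (VP i)); pose j w := sval (cid (piece_index w)).
have VV i := svalP (cid (VP i)); have jP w : A (j w) w := svalP (cid (piece_index w)).
exists (fun w => V (j w) w); split=> [w|w|E mE].
- by have [VF _ _] := VV (j w); exact: VF.
- by move=> N; have [_ VN _] := VV (j w); exact: VN.
- apply: localizable_ae => i; case: (VV i) => _ _ /(_ E mE).
  by apply: filterS => w VE Aw; rewrite (piece_index_uniq (jP w) Aw); exact: VE.
Qed.

End localizable.

(** * Measurability of scalar and vector-valued functions *)

Lemma ofR_gt0 {R : realType} {k : scalars} (e : R) : (0 < ofR k e) = (0 < e).
Proof. by rewrite !lt0r -(ofR0 (R := R) (k := k)) ler_ofR (inj_eq (can_inj (@ofRK R k))). Qed.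

Section normed_modules.
Context {R : realType} {k : scalars}.
Local Notation K := (scalar_field R k).
Variable E : normedModType K.

Lemma rnormN (x : E) : rnorm (- x) = rnorm x.
Proof. by rewrite /rnorm normrN. Qed.

Lemma rnorm_dist (x y : E) : rnorm (x - y) = rnorm (y - x).
Proof. by rewrite -rnormN opprB. Qed.

Lemma ler_rnorm_dist (x y z : E) : rnorm (x - z) <= rnorm (x - y) + rnorm (y - z).
Proof. by rewrite -(subrKA y x) ; exact: ler_rnormD. Qed.

Lemma lt_rnorm (x : E) (e : R) : (`|x| < ofR k e) = (rnorm x < e).
Proof.
rewrite -(rnormK x) lt_neqAle ler_ofR (inj_eq (can_inj (@ofRK R k))).
by rewrite -lt_neqAle.
Qed.

Lemma cvg_rnormP (X : Type) (G : set_system X) (FG : Filter G) (f : X -> E) z :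
  f @ G --> z <-> forall e : R, 0 < e -> \forall x \near G, rnorm (z - f x) < e.
Proof.
split=> [/cvgrPdist_lt fz e e0|fz]; last apply/cvgrPdist_lt => e e0.
  have := fz (ofR k e); rewrite ofR_gt0 => /(_ e0).
  by apply: filterS => x; rewrite lt_rnorm.
have := fz (toR e); rewrite -(ofR_gt0 (k := k)) toRK ?ltW// => /(_ e0).
by apply: filterS => x; rewrite -lt_rnorm toRK// ltW.
Qed.

End normed_modules.

Definition imK (R : realType) (k : scalars) : scalar_field R k -> R :=
  match k with RealScalars => fun=> 0 | ComplexScalars => fun z => complex.Im z end.

Definition mkK (R : realType) (k : scalars) (a b : R) : scalar_field R k :=
  match k with RealScalars => a | ComplexScalars => (a +i* b)%C end.

Section scalars.
Context {R : realType} {k : scalars}.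
Local Notation K := (scalar_field R k).
Local Notation rn z := (rnorm (z : K^o)).
Implicit Types (z : K) (r e : R).

Lemma toRD z z' : toR (z + z') = toR z + toR z'.
Proof. by case: k z z' => //= -[a b] [a' b']. Qed.

Lemma toRN z : toR (- z) = - toR z.
Proof. by case: k z => //= -[a b]. Qed.

Lemma imKD z z' : imK (z + z') = imK z + imK z'.
Proof. by rewrite /imK; case: k z z' => //= [? ?|[a b] [a' b']]; rewrite ?addr0. Qed.

Lemma imKN z : imK (- z) = - imK z.
Proof. by rewrite /imK; case: k z => //= [?|[a b]]; rewrite ?oppr0. Qed.

Lemma rn_toR z : `|toR z| <= rn z.
Proof.
rewrite /rnorm; case: k z => //= -[a b].
by rewrite /Normc.normc /= -sqrtr_sqr ler_sqrt ?lerDl ?sqr_ge0// addr_ge0 ?sqr_ge0.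
Qed.

Lemma rn_imK z : `|imK z| <= rn z.
Proof.
rewrite /rnorm /imK; case: k z => /= [?|[a b]]; first by rewrite normr0.
by rewrite /Normc.normc /= -sqrtr_sqr ler_sqrt ?lerDr ?sqr_ge0// addr_ge0 ?sqr_ge0.
Qed.

Lemma rn_le z : rn z <= `|toR z| + `|imK z|.
Proof.
rewrite /rnorm /imK; case: k z => /= [?|[a b]]; first by rewrite normr0 addr0.
rewrite /Normc.normc /= -(@ler_pXn2r _ 2) ?nnegrE ?sqrtr_ge0 ?addr_ge0//.
rewrite sqr_sqrtr ?addr_ge0 ?sqr_ge0// sqrrD (real_normK (num_real a)) (real_normK (num_real b)).
by rewrite -addrA lerD2l lerDr mulrn_wge0 // mulr_ge0.
Qed.

Lemma toR_mk (a b : R) : toR (mkK k a b) = a.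
Proof. by rewrite /mkK; case: k. Qed.

Lemma rn_mk z (a b : R) : rn (z - mkK k a b) <= `|toR z - a| + `|imK z - b|.
Proof.
rewrite (le_trans (rn_le _))// toRD imKD toRN imKN toR_mk lerD2l /mkK /imK.
by case: k z => //= ?; rewrite oppr0 addr0 normr0.
Qed.

Lemma ballE z e : ball z (ofR k e) = [set z' | rn (z - z') < e].
Proof. by apply/seteqP; split=> z'; rewrite -ball_normE /= (lt_rnorm (z - z' : K^o)). Qed.

Lemma openP_rn (O : set K) : open O <->
  forall z, O z -> exists2 e, 0 < e & [set z' | rn (z - z') < e] `<=` O.
Proof.
rewrite openE; split=> OO z /OO.
  move=> /nbhs_ballP[e e0 eO]; exists (toR e); first by rewrite -(ofR_gt0 (k := k)) toRK ?ltW.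
  by rewrite -ballE toRK// ltW.
move=> [e e0 eO]; apply/nbhs_ballP; exists (ofR k e); first by rewrite /= ofR_gt0.
by rewrite ballE.
Qed.

Lemma cvgP_rn (X : Type) (F : set_system X) (FF : Filter F) (f : X -> K) z :
  f @ F --> z <-> forall e, 0 < e -> \forall x \near F, rn (z - f x) < e.
Proof. exact: (cvg_rnormP (E := K^o)). Qed.

(** The real and imaginary parts stay in the compact interval from [- c] to [c], where image
    ultrafilters converge. *)
Lemma ultra_cvg (X : Type) (V : set_system X) (f : X -> K) (c : R) :
  UltraFilter V -> V [set x | rn (f x) <= c] -> exists z : K, f @ V --> z.
Proof.
move=> UV Vc.
have real_cvg (g : X -> R) : (forall x, `|g x| <= rn (f x)) -> exists a : R, g @ V --> a.
  move=> gf; have gV : UltraFilter (g @ V).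
    split=> [|G GF VG]; first exact: fmap_proper_filter.
    apply/seteqP; split=> // A GA.
    have [//|] := in_ultra_setVsetC (g @^-1` A) UV.
    move=> VA; have GAC : G (~` A) by exact: VG.
    by have : G (A `&` ~` A) by [exact: filterI]; rewrite setICr => /filter_not_empty.
  have := @segment_compact R (- c) c; rewrite compact_ultra => /(_ _ gV)[|a [_ ga]].
    change (V (g @^-1` `[- c, c]%classic)).
    by apply: filterS Vc => x /(le_trans (gf x)); rewrite /= in_itv/= ler_norml.
  by exists a.
have [a fa] := real_cvg (fun x => toR (f x)) (fun x => rn_toR (f x)).
have [b fb] := real_cvg (fun x => imK (f x)) (fun x => rn_imK (f x)).
exists (mkK k a b); apply/cvgP_rn => e e0.
have e20 : 0 < e / 2 by rewrite divr_gt0.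
move/cvgrPdist_lt : fa => /(_ _ e20) fa; move/cvgrPdist_lt : fb => /(_ _ e20) fb.
apply: filterS2 fa fb => x fa fb.
rewrite rnorm_dist (le_lt_trans (rn_mk _ _ _))//.
by rewrite distrC [X in _ + X]distrC; lra.
Qed.

Lemma cvg_rn_toR (X : Type) (F : set_system X) (FF : Filter F) (f : X -> K) z :
  f @ F --> z -> (fun x => toR (f x)) @ F --> toR z.
Proof.
move=> /cvgP_rn fz; apply/cvgrPdist_lt => e /fz; apply: filterS => x.
by rewrite -toRN -toRD; apply: le_lt_trans; exact: rn_toR.
Qed.

Lemma cvg_rn_imK (X : Type) (F : set_system X) (FF : Filter F) (f : X -> K) z :
  f @ F --> z -> (fun x => imK (f x)) @ F --> imK z.
Proof.
move=> /cvgP_rn fz; apply/cvgrPdist_lt => e /fz; apply: filterS => x.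
by rewrite -imKN -imKD; apply: le_lt_trans; exact: rn_imK.
Qed.

End scalars.

Section scalar_measurability.
Context {d : measure_display} {T : measurableType d} {R : realType} {k : scalars}.
Local Notation K := (scalar_field R k).
Local Notation rn z := (rnorm (z : K^o)).
Implicit Types (f g : T -> K).

Lemma scalar_measurableP g : scalar_measurable g <->
  forall O : set K, open O -> measurable (g @^-1` O).
Proof.
split=> [mg O oO|gO].
  rewrite -[X in measurable X]setTI; apply: mg => //.
  exact: sub_sigma_algebra.
apply: (@measurability _ _ _ (g_sigma_algebraType (@open K)) _ _ (@open K)) => //.
by move=> _ [Y oY <-]; rewrite setTI; exact: gO.
Qed.

Lemma scalar_measurable_lip g (phi : K -> R) :
  (forall z z', `|phi z - phi z'| <= rn (z - z')) ->
  scalar_measurable g -> measurable_fun [set: T] (phi \o g).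
Proof.
move=> phil /scalar_measurableP mg.
apply: (measurability _ (RGenInftyO.measurableE R)) => _ [_ [r ->] <-].
rewrite setTI comp_preimage; apply: mg; apply/openP_rn => z /=.
rewrite in_itv/= => zr; exists (r - phi z); first by rewrite subr_gt0.
move=> z' /=; rewrite in_itv/= => zz'; have := phil z z'.
rewrite ler_norml => /andP[+ _]; lra.
Qed.

(** Conversely, an open set is the union of the countably many rational boxes that it contains. *)
Lemma scalar_measurable_ReIm g : scalar_measurable g <->
  measurable_fun [set: T] (fun w => toR (g w)) /\
  measurable_fun [set: T] (fun w => imK (g w)).
Proof.
split=> [mg|[mr mi]].
  split; [apply: (scalar_measurable_lip (phi := @toR R k)) mg => z z'|
          apply: (scalar_measurable_lip (phi := @imK R k)) mg => z z'].
    by rewrite -toRN -toRD; exact: rn_toR.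
  by rewrite -imKN -imKD; exact: rn_imK.
apply/scalar_measurableP => O /openP_rn oO.
pose box (q : rat * rat * nat) :=
  [set z : K | `|toR z - ratr q.1.1| < q.2.+1%:R^-1 /\ `|imK z - ratr q.1.2| < q.2.+1%:R^-1].
pose S (q : rat * rat * nat) := if pselect (box q `<=` O) then g @^-1` (box q) else set0.
have -> : g @^-1` O = \bigcup_q S q.
  apply/seteqP; split=> [w /= Ow|w [q _]]; last first.
    by rewrite /S; case: pselect => // qO; exact: qO.
  have [e e0 eO] := oO _ Ow.
  (* Two points of a box of radius below [e / 4] differ by less than [e / 2] in each coordinate,
     hence by less than [e]. *)
  pose n := Num.truncn (4 / e).
  have ne : n.+1%:R^-1 < e / 4.
    by rewrite invf_plt ?posrE ?divr_gt0// invf_div truncnS_gt.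
  have n0 : 0 < n.+1%:R^-1 :> R by rewrite invr_gt0.
  have rat_near (x : R) : exists q : rat, `|x - ratr q| < n.+1%:R^-1.
    have : x < x + n.+1%:R^-1 by rewrite ltrDl.
    move=> /rat_in_itvoo[q]; rewrite in_itv/= => /andP[xq qx]; exists q.
    rewrite ltr_distlC; apply/andP; split; last exact: qx.
    by apply: lt_trans xq; rewrite gtrBl.
  have [qa qaP] := rat_near (toR (g w)); have [qb qbP] := rat_near (imK (g w)).
  exists (qa, qb, n) => //; rewrite /S; case: pselect => // -[] z [/= za zb].
  apply: eO => /=; rewrite (le_lt_trans (rn_le _))// toRD imKD toRN imKN.
  have close (x y q dl : R) : `|x - q| < dl -> `|y - q| < dl -> dl < e / 4 ->
      `|x - y| < e / 2.
    by rewrite !ltr_norml => /andP[? ?] /andP[? ?] ?; apply/andP; split; lra.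
  rewrite (splitr e); apply: ltrD.
    exact: close qaP za ne.
  exact: close qbP zb ne.
apply: countable_bigcupT_measurable => // q.
rewrite /S; case: pselect => [qO|nqO]; last exact: measurable0.
have mball (h : T -> R) (a r : R) : measurable_fun [set: T] h ->
    measurable [set w | `|h w - a| < r].
  move=> mh; have -> : [set w | `|h w - a| < r] = [set: T] `&` h @^-1` `]a - r, a + r[%classic.
    by rewrite setTI; apply/seteqP; split=> w /=; rewrite in_itv/= ltr_distl.
  exact: mh.
by apply: measurableI; exact: mball.
Qed.

Lemma scalar_measurableD f g : scalar_measurable f -> scalar_measurable g ->
  scalar_measurable (fun w => f w + g w).
Proof.
move=> /scalar_measurable_ReIm[f1 f2] /scalar_measurable_ReIm[g1 g2].
apply/scalar_measurable_ReIm; split.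
  by under eq_fun do rewrite toRD; exact: measurable_funD.
by under eq_fun do rewrite imKD; exact: measurable_funD.
Qed.

Lemma scalar_measurable_cst (c : K) : scalar_measurable (cst c : T -> K).
Proof. exact: measurable_cst. Qed.

Lemma scalar_measurable_sum (I : Type) (s : seq I) (f : I -> T -> K) :
  (forall i, scalar_measurable (f i)) ->
  scalar_measurable (fun w => \sum_(i <- s) f i w).
Proof.
move=> mf; elim: s => [|i s IH].
  under eq_fun do rewrite big_nil; exact: scalar_measurable_cst.
by under eq_fun do rewrite big_cons; exact: scalar_measurableD.
Qed.

Lemma scalar_measurable_lim (f : nat -> T -> K) g :
  (forall n, scalar_measurable (f n)) -> (forall w, f ^~ w @ \oo --> g w) ->
  scalar_measurable g.
Proof.
move=> mf fg; apply/scalar_measurable_ReIm; split.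
- apply: (measurable_fun_cvg (h := fun n w => toR (f n w))).
    by move=> n; case/scalar_measurable_ReIm : (mf n).
  by move=> w _; exact: cvg_rn_toR (fg w).
- apply: (measurable_fun_cvg (h := fun n w => imK (f n w))).
    by move=> n; case/scalar_measurable_ReIm : (mf n).
  by move=> w _; exact: cvg_rn_imK (fg w).
Qed.

Lemma scalar_measurable_rn g (c : K) : scalar_measurable g ->
  measurable_fun [set: T] (fun w => rn (g w - c)).
Proof.
apply: (scalar_measurable_lip (phi := fun z => rn (z - c))) => z z'.
have tri (x y : K^o) : rnorm (x - (c : K^o)) <= rnorm (x - y) + rnorm (y - (c : K^o)).
  exact: ler_rnorm_dist.
have h1 := tri z z'; have h2 := tri z' z; rewrite (rnorm_dist (z' : K^o) z) in h2.
rewrite ler_norml; apply/andP; split; last by rewrite lerBlDr; exact: h1.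
by rewrite lerNl opprB lerBlDr; exact: h2.
Qed.

Lemma scalar_measurable_ae (mu : {measure set T -> \bar R}) f g :
  measure_is_complete mu -> {ae mu, forall w, f w = g w} ->
  scalar_measurable f -> scalar_measurable g.
Proof.
move=> cmu [N [mN N0 fgN]] /scalar_measurableP mf; apply/scalar_measurableP => O oO.
have -> : g @^-1` O = (f @^-1` O `\` N) `|` (g @^-1` O `&` N).
  have fgE w : ~ N w -> f w = g w by move=> Nw; apply: contrapT => fg; exact/Nw/fgN.
  apply/seteqP; split=> w /=.
    by move=> gO; case: (pselect (N w)) => Nw; [right|left; rewrite (fgE w)].
  by case=> [[fO Nw]|[]//]; rewrite -fgE.
apply: measurableU; first by apply: measurableD => //; exact: mf.
by apply: cmu; exists N; split=> // w [].
Qed.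

Lemma scalar_measurable_indic f (S : set T) : measurable S -> scalar_measurable f ->
  scalar_measurable (fun w => if pselect (S w) then f w else 0).
Proof.
move=> mS /scalar_measurableP mf; apply/scalar_measurableP => O oO.
rewrite (_ : _ @^-1` O = (S `&` f @^-1` O) `|` (~` S `&` [set w | O 0])); last first.
  apply/seteqP; split=> w /=.
    by case: pselect => Sw Ow; [left|right].
  by case: pselect => Sw [[]|[]].
apply: measurableU; first by apply: measurableI => //; exact: mf.
apply: measurableI; first exact: measurableC.
case: (pselect (O 0)) => O0.
  by rewrite (_ : [set _ | _] = setT)//; apply/seteqP; split.
by rewrite (_ : [set _ | _] = set0)//; apply/seteqP; split.
Qed.

End scalar_measurability.

Section bounded_operators.
Context {R : realType} {k : scalars}.
Local Notation K := (scalar_field R k).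
Variables E F : normedModType K.

Lemma operator_of_bound (f : E -> F) (c : R) :
  linear f -> (forall x, rnorm (f x) <= c * rnorm x) ->
  exists S : 'L(E, F), forall x, S x = f x.
Proof.
move=> lf fc; suff fP : is_bounded_operator f by exists (BoundedOperator fP).
apply/asboolP; split=> // x; apply: (cvg_rnormP _ f (f x)).2 => e e0.
have c1 : 0 < `|c| + 1 by rewrite ltr_wpDl.
have : \forall y \near x, rnorm (x - y) < e / (`|c| + 1).
  by apply: (cvg_rnormP _ id x).1 (divr_gt0 e0 c1); exact: cvg_id.
apply: filterS => y /= xy.
have -> : f x - f y = f (x - y).
  by have := lf (- 1) y x; rewrite !scaleN1r addrC => <-; rewrite addrC.
rewrite (le_lt_trans (fc _))//; move: xy; rewrite ltr_pdivlMr//.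
apply: le_lt_trans; rewrite mulrC ler_wpM2l ?rnorm_ge0//.
by rewrite (le_trans (ler_norm c))// lerDl.
Qed.

Lemma opnorm_le_bound (S : 'L(E, F)) (c : R) : 0 <= c ->
  (forall x, rnorm (S x) <= c * rnorm x) -> opnorm S <= c.
Proof.
move=> c0 Sc; apply: opnorm_le => x x1; rewrite (le_trans (Sc x))//.
by rewrite -[leRHS]mulr1 ler_wpM2l.
Qed.

End bounded_operators.

Section duals.
Context {R : realType} {k : scalars}.
Local Notation K := (scalar_field R k).
Variables F : normedModType K.
Local Notation rn z := (rnorm (z : K^o)).

Lemma dual_le (phi : dual F) v : rn (phi v) <= rnorm phi * rnorm v.
Proof. by rewrite (rnorm_opnorm phi); exact: opnormP. Qed.

Lemma dual_norming (phi : dual F) (e : R) : 0 < e ->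
  exists2 v : F, rnorm v <= 1 & rnorm phi - e < rn (phi v).
Proof.
move=> e0; have := sup_adherent e0 (bounded_operator_ball phi).
by move=> [_ [v v1 <-]]; rewrite -/(opnorm phi) -rnorm_opnorm; exists v.
Qed.

Lemma evaluation (v : F) : exists ev : dual (dual F), forall phi, ev phi = phi v.
Proof.
apply: (operator_of_bound (c := rnorm v)) => [//|phi].
by rewrite mulrC; exact: dual_le.
Qed.

End duals.

Lemma countable_enum (X : pointedType) (D : set X) : countable D ->
  exists e : nat -> X, forall x, D x -> exists n, e n = x.
Proof.
move=> /pcard_leP[f]; exists (fun n => xget point [set x | D x /\ f x = n]) => x Dx.
exists (f x); case: xgetP => [y -> [Dy fyx]|/(_ x)]; last by case.
by apply: inj fyx; exact: mem_set.
Qed.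

(** * Strong measurability with values in a dual space *)

Section strong_measurability.
Context {d : measure_display} {T : measurableType d} {R : realType} {k : scalars}.
Local Notation K := (scalar_field R k).
Variable mu : {measure set T -> \bar R}.
Local Notation rn z := (rnorm (z : K^o)).

(** Almost separable values in terms of a sequence; the [e n] need not be values of [f]. *)
Definition ae_dense_range (E : normedModType K) (f : T -> E) (e : nat -> E) :=
  {ae mu, forall w, forall r : R, 0 < r -> exists n, rnorm (f w - e n) < r}.

Lemma almost_separably_valuedP (E : normedModType K) (f : T -> E) :
  almost_separably_valued mu f <-> exists e, ae_dense_range f e.
Proof.
split=> [[D cD Df]|[e fe]].
  have [e eD] := countable_enum cD; exists e; apply: filterS Df => w Dw r r0.
  have := Dw (ball (f w) (ofR k r)); rewrite -ball_normE => /(_ _)[|x [Dx]].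
    by rewrite ball_normE; apply: nbhsx_ballx; rewrite ofR_gt0.
  by move=> /=; rewrite lt_rnorm; have [n <-] := eD _ Dx; exists n.
exists (range e); first exact: card_image_le.
apply: filterS fe => w fe B /nbhs_ballP[r r0 rB].
have := fe (toR r); rewrite -(ofR_gt0 (k := k)) toRK ?ltW// => /(_ r0)[n].
rewrite -lt_rnorm toRK ?ltW// => en; exists (e n); split; first by exists n.
by apply: rB; rewrite -ball_normE.
Qed.

Hypothesis mu_complete : measure_is_complete mu.
Variable F : normedModType K.

Lemma strongly_measurable_eval (f : T -> dual F) v :
  strongly_measurable mu f -> scalar_measurable (fun w => f w v).
Proof.
move=> [wf _]; have [ev evE] := evaluation v.
by have := wf ev; congr scalar_measurable; apply/funext => w; rewrite evE.
Qed.

(** By separability, countably many vectors [v (n, m)], nearly norming [e n - c], compute the norm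
    almost everywhere. The superlevel set of the norm thus differs from the measurable set [S] by a
    null set, which is measurable by completeness. *)
Lemma strongly_measurable_rnorm (f : T -> dual F) (c : dual F) :
  strongly_measurable mu f -> measurable_fun [set: T] (fun w => rnorm (f w - c)).
Proof.
move=> sf; have [_ /almost_separably_valuedP[e fe]] := sf.
apply: (measurability _ (RGenOInfty.measurableE R)) => _ [_ [r ->] <-].
rewrite setTI.
have v_ex (q : nat * nat) : exists v : F,
    rnorm v <= 1 /\ rnorm (e q.1 - c) - q.2.+1%:R^-1 < rn ((e q.1 - c) v).
  have [|v v1 vP] := @dual_norming _ _ _ (e q.1 - c) q.2.+1%:R^-1.
    by rewrite invr_gt0.
  by exists v.
pose v q := sval (cid (v_ex q)).
have vP q : rnorm (v q) <= 1 /\ rnorm (e q.1 - c) - q.2.+1%:R^-1 < rn ((e q.1 - c) (v q)).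
  exact: svalP (cid (v_ex q)).
pose S := \bigcup_q [set w | r < rn ((f w - c) (v q))].
have mS : measurable S.
  apply: countable_bigcupT_measurable => // q.
  have := scalar_measurable_rn (c (v q)) (strongly_measurable_eval (v q) sf).
  move=> /(_ measurableT `]r, +oo[%classic (measurable_itv _)); rewrite setTI.
  congr measurable; apply/seteqP; split=> w /=; by rewrite in_itv/= andbT.
have Sf : S `<=` [set w | r < rnorm (f w - c)].
  move=> w [q _ /= rq]; apply: (lt_le_trans rq).
  have := dual_le (f w - c) (v q); move=> /le_trans; apply.
  by rewrite -[leRHS]mulr1 ler_wpM2l ?rnorm_ge0//; case: (vP q).
have -> : (fun w => rnorm (f w - c)) @^-1` `]r, +oo[%classic =
    S `|` ([set w | r < rnorm (f w - c)] `\` S).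
  apply/seteqP; split=> w /=; rewrite in_itv/= andbT; last by case=> [/Sf|[]].
  by move=> rw; case: (pselect (S w)) => Sw; [left|right].
apply: measurableU => //; apply: mu_complete; apply: negligibleS fe.
move=> w /= [rw nS] fw; apply: nS.
(* One third for each error: replacing [f w] by [e n] in norm, the norming defect of [v (n, m)], and
   returning from [e n] to [f w] at that vector. *)
pose a := (rnorm (f w - c) - r) / 3.
have a0 : 0 < a by rewrite /a; lra.
have [n nw] := fw _ a0.
pose m := Num.truncn a^-1.
have ma : m.+1%:R^-1 < a by rewrite invf_plt ?posrE// truncnS_gt.
exists (n, m) => //=; have [v1 vm] := vP (n, m); move: v1 vm => /=.
set u := v (n, m) => v1 vm.
have h1 : rn ((e n - f w) u) < a.
  apply: le_lt_trans (dual_le _ _) _; rewrite rnorm_dist in nw.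
  by apply: le_lt_trans nw; rewrite -[leRHS]mulr1 ler_wpM2l ?rnorm_ge0.
have h2 : rn ((e n - c) u) <= rn ((e n - f w) u) + rn ((f w - c) u).
  rewrite (_ : (e n - c) u = (e n - f w) u + (f w - c) u) ?ler_rnormD//.
  by rewrite -[RHS]/((e n - f w + (f w - c)) u) subrKA.
have h3 : rnorm (f w - c) <= rnorm (f w - e n) + rnorm (e n - c) by exact: ler_rnorm_dist.
have arith (A B n' D G h dl : R) : A <= n' + B -> n' < (A - r) / 3 -> B - dl < D ->
    dl < (A - r) / 3 -> D <= h + G -> h < (A - r) / 3 -> r < G.
  by clear; lra.
exact: arith h3 nw vm ma h2 h1.
Qed.

End strong_measurability.

(** * Local operators on Bochner spaces *)

Section Lnorm_lemmas.
Context {d : measure_display} {T : measurableType d} {R : realType}.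
Variable mu : {measure set T -> \bar R}.
Variable p : \bar R.
Hypothesis p1 : (1 <= p)%E.

Lemma ae_le_Lnorm (f g : T -> R) :
  measurable_fun [set: T] f -> measurable_fun [set: T] g ->
  (forall w, 0 <= f w) -> (forall w, 0 <= g w) ->
  {ae mu, forall w, f w <= g w} ->
  (Lnorm mu p (fun w => (f w)%:E) <= Lnorm mu p (fun w => (g w)%:E))%E.
Proof.
move=> mf mg f0 g0 fg; rewrite unlock; case: p p1 => [r r1|_|//]; last first.
  case: ifPn => // mu0; apply: le_ess_sup; apply: filterS fg => w fg /=.
  by rewrite lee_fin !ger0_norm.
rewrite lee_fin in r1; have r0 : 0 < r by exact: lt_le_trans r1.
apply: gt0_ler_poweR.
- by rewrite invr_ge0 ltW.
- by rewrite in_itv/= leey andbT; apply: integral_ge0 => w _; rewrite lee_fin powR_ge0.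
- by rewrite in_itv/= leey andbT; apply: integral_ge0 => w _; rewrite lee_fin powR_ge0.
apply: ae_ge0_le_integral => //.
- by move=> w _; exact: poweR_ge0.
- apply: (measurableT_comp (measurable_poweR r)).
  by apply: measurableT_comp => //; exact/measurable_EFinP.
- by move=> w _; exact: poweR_ge0.
- apply: (measurableT_comp (measurable_poweR r)).
  by apply: measurableT_comp => //; exact/measurable_EFinP.
apply: filterS fg => w fg _; apply: gt0_ler_poweR.
- exact: ltW.
- by rewrite in_itv/= leey andbT lee_fin.
- by rewrite in_itv/= leey andbT lee_fin.
by rewrite /= lee_fin !ger0_norm.
Qed.

(** [c] is the norm of the indicator: a power of [mu S] for finite [p], and 0 or 1 for infinite [p].
    Homogeneity and positivity are what later lets all exponents be treated alike. *)
Lemma Lnorm_indic (S : set T) : measurable S -> (mu S < +oo)%E ->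
  exists c : R, [/\ 0 <= c, (0 < mu S)%E -> 0 < c &
    forall a : R, 0 <= a -> Lnorm mu p (fun w => (a * \1_S w)%:E) = (a * c)%:E].
Proof.
move=> mS Soo; have Sfin : mu S \is a fin_num by rewrite ge0_fin_numE.
rewrite unlock; case: p p1 => [r r1|_|//]; last first.
  have [S0|S0] := eqVneq (mu S) 0%E.
    exists 0; split=> //; first by rewrite S0 ltxx.
    move=> a a0; case: ifPn => mu0; rewrite mulr0//.
    apply: ess_sup_ae_cst => //; exists S; split=> // w /= nw.
    by apply: contrapT => Sw; apply: nw; rewrite indicE memNset// mulr0 normr0.
  have {}S0 : (0 < mu S)%E by rewrite lt_def S0 measure_ge0.
  have mu0 : (0 < mu [set: T])%E.
    by apply: (lt_le_trans S0); rewrite le_measure// inE.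
  exists 1; split=> // a a0; rewrite mu0 mulr1; apply/eqP; rewrite eq_le; apply/andP; split.
    apply/ess_supP; apply: aeW => w /=; rewrite lee_fin ger0_norm ?mulr_ge0//.
    by rewrite -[leRHS]mulr1 ler_wpM2l// indicE; case: (_ \in _).
  rewrite leNgt; apply/negP => lta.
  have /ess_supP[N [mN N0 HN]] := lexx (ess_sup mu (abse \o (fun w => (a * \1_S w)%:E))).
  suff SN : S `<=` N.
    by move: S0; rewrite lt_neqAle eq_sym => /andP[/eqP + _]; apply; exact: subset_measure0 N0.
  move=> w Sw; apply: HN => /=; rewrite indicE mem_set// mulr1 ger0_norm//.
  by apply/negP; rewrite -ltNge.
rewrite lee_fin in r1; have r0 : 0 < r by exact: lt_le_trans r1.
exists (fine (mu S) `^ r^-1); split.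
- exact: powR_ge0.
- by move=> S0; apply: powR_gt0; apply: fine_gt0; rewrite S0 Soo.
move=> a a0.
have -> : (\int[mu]_x (`|(a * \1_S x)%:E| `^ r) = \int[mu]_(x in S) cst ((a `^ r)%:E) x)%E.
  rewrite [RHS]integral_mkcond; apply: eq_integral => w _.
  rewrite patchE /= ger0_norm ?mulr_ge0// indicE.
  by case: ifPn => wS; rewrite ?mulr1// mulr0 powR0// gt_eqF.
rewrite integral_cst// poweRM ?lee_fin ?powR_ge0//.
rewrite poweR_EFin -powRrM mulfV ?gt_eqF// powRr1// EFinM; congr (_ * _)%E.
by rewrite -{1}(fineK Sfin) poweR_EFin.
Qed.

End Lnorm_lemmas.

Definition restr (T : Type) (V : nmodType) (S : set T) (f : T -> V) : T -> V :=
  fun w => if pselect (S w) then f w else 0.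

Lemma restrT (T : Type) (V : nmodType) (S : set T) (f : T -> V) w :
  S w -> restr S f w = f w.
Proof. by rewrite /restr; case: pselect. Qed.

Lemma restrN (T : Type) (V : nmodType) (S : set T) (f : T -> V) w :
  ~ S w -> restr S f w = 0.
Proof. by rewrite /restr; case: pselect. Qed.

Section strong_measurability_closure.
Context {d : measure_display} {T : measurableType d} {R : realType} {k : scalars}.
Local Notation K := (scalar_field R k).
Variable mu : {measure set T -> \bar R}.
Variable E : normedModType K.
Implicit Types f g : T -> E.

Lemma strongly_measurable_cst (c : E) : strongly_measurable mu (cst c : T -> E).
Proof.
split; first by move=> phi; exact: (scalar_measurable_cst (phi c)).
apply/almost_separably_valuedP; exists (fun=> c); apply: aeW => w r r0.
by exists 0%N; rewrite /= subrr rnorm0.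
Qed.

Lemma strongly_measurable_restr f (S : set T) :
  measurable S -> strongly_measurable mu f -> strongly_measurable mu (restr S f).
Proof.
move=> mS [wf /almost_separably_valuedP[e fe]]; split.
  move=> phi; have := scalar_measurable_indic mS (wf phi).
  congr scalar_measurable; apply/funext => w; rewrite /restr.
  by case: pselect => // nSw; rewrite linear0.
apply/almost_separably_valuedP.
exists (fun n => if n is n'.+1 then e n' else 0).
apply: filterS fe => w fe r r0; rewrite /restr; case: pselect => Sw.
  by have [n en] := fe _ r0; exists n.+1.
by exists 0%N; rewrite subrr rnorm0.
Qed.

Lemma strongly_measurable_subc f (c : E) :
  strongly_measurable mu f -> strongly_measurable mu (fun w => f w - c).
Proof.
move=> [wf /almost_separably_valuedP[e fe]]; split.
  move=> phi; have := scalar_measurableD (wf phi) (scalar_measurable_cst (- phi c)).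
  by congr scalar_measurable; apply/funext => w; rewrite linearB.
apply/almost_separably_valuedP; exists (fun n => e n - c).
apply: filterS fe => w fe r /fe[n en]; exists n.
by rewrite opprB addrA subrK.
Qed.

End strong_measurability_closure.

(** * Pointwise bounds for local operators *)

Section Lp_dual.
Context {d : measure_display} {T : measurableType d} {R : realType} {k : scalars}.
Local Notation K := (scalar_field R k).
Variable mu : {measure set T -> \bar R}.
Hypothesis mu_complete : measure_is_complete mu.
Variables (p : \bar R) (p1 : (1 <= p)%E).
Variable F : normedModType K.
Local Notation E := (dual F).
Implicit Types f g : T -> E.

Lemma measurable_rnorm f : strongly_measurable mu f ->
  measurable_fun [set: T] (fun w => rnorm (f w)).
Proof.
move=> /(strongly_measurable_rnorm mu_complete 0).
by congr measurable_fun; apply/funext => w; rewrite subr0.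
Qed.

Lemma bochner_norm_bounded f (S : set T) (c e : R) :
  measurable S -> strongly_measurable mu f -> 0 <= e ->
  (forall a : R, 0 <= a -> Lnorm mu p (fun w => (a * \1_S w)%:E) = (a * c)%:E) ->
  (forall w, S w -> rnorm (f w) <= e) ->
  (bochner_norm mu p (restr S f) <= (e * c)%:E)%E.
Proof.
move=> mS mf e0 Sc fe; rewrite -Sc//; apply: ae_le_Lnorm => //.
- by apply: measurable_rnorm; exact: strongly_measurable_restr.
- by apply: measurable_funM => //; exact: measurable_indic.
- by move=> w; exact: rnorm_ge0.
- by move=> w; rewrite mulr_ge0.
apply: aeW => w; rewrite /restr indicE; case: pselect => Sw.
  by rewrite mem_set// mulr1 fe.
by rewrite rnorm0 mulr_ge0.
Qed.

Lemma bochner_norm_lower f (S : set T) (c e : R) :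
  measurable S -> strongly_measurable mu f -> 0 <= e ->
  (forall a : R, 0 <= a -> Lnorm mu p (fun w => (a * \1_S w)%:E) = (a * c)%:E) ->
  {ae mu, forall w, S w -> e <= rnorm (f w)} ->
  ((e * c)%:E <= bochner_norm mu p f)%E.
Proof.
move=> mS mf e0 Sc fe; rewrite -Sc//; apply: ae_le_Lnorm => //.
- by apply: measurable_funM => //; exact: measurable_indic.
- exact: measurable_rnorm.
- by move=> w; rewrite mulr_ge0.
- by move=> w; exact: rnorm_ge0.
apply: filterS fe => w fe; rewrite indicE; case: (pselect (S w)) => Sw.
  by rewrite mem_set// mulr1 fe.
by rewrite memNset// mulr0 rnorm_ge0.
Qed.

Lemma in_Lp_bounded f (S : set T) (e : R) :
  measurable S -> (mu S < +oo)%E -> strongly_measurable mu f ->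
  (forall w, S w -> rnorm (f w) <= e) -> in_Lp mu p (restr S f).
Proof.
move=> mS Soo mf fe; split; first exact: strongly_measurable_restr.
have [c [c0 _ Sc]] := Lnorm_indic p1 mS Soo.
apply: (le_lt_trans (@bochner_norm_bounded _ _ c `|e| mS mf _ Sc _)) => //.
  by move=> w /fe fw; exact: le_trans fw (ler_norm e).
exact: ltry.
Qed.

Lemma in_Lp_restr f (S : set T) : measurable S -> in_Lp mu p f ->
  in_Lp mu p (restr S f).
Proof.
move=> mS [mf foo]; split; first exact: strongly_measurable_restr.
apply: le_lt_trans foo; apply: ae_le_Lnorm => //.
- by apply: measurable_rnorm; exact: strongly_measurable_restr.
- exact: measurable_rnorm.
- by move=> w; exact: rnorm_ge0.
- by move=> w; exact: rnorm_ge0.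
apply: aeW => w; rewrite /restr; case: pselect => // nSw.
by rewrite rnorm0 rnorm_ge0.
Qed.

Lemma in_Lp_cst (c : E) (S : set T) : measurable S -> (mu S < +oo)%E ->
  in_Lp mu p (restr S (cst c)).
Proof.
move=> mS Soo; apply: (in_Lp_bounded (e := rnorm c)) => //.
exact: strongly_measurable_cst.
Qed.

Variable T_ : (T -> E) -> (T -> E).
Hypothesis TLp : Lp_operator mu p T_.
Hypothesis Tloc : local_operator mu p T_.

(** [f] is the sum of its restrictions to [S] and to the complement, and by locality the image of
    the latter vanishes almost everywhere on [S]. *)
Lemma local_restr f (S : set T) : measurable S -> in_Lp mu p f ->
  {ae mu, forall w, S w -> T_ (restr S f) w = T_ f w}.
Proof.
move=> mS fLp; have [_ _ Tlin _] := TLp.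
have mSc := measurableC mS.
have := Tlin 1 _ _ (in_Lp_restr mS fLp) (in_Lp_restr mSc fLp).
have -> : (fun x => 1 *: restr S f x + restr (~` S) f x) = f.
  apply/funext => w; rewrite scale1r; case: (pselect (S w)) => Sw.
    by rewrite restrT// restrN ?addr0//=; apply/not_notP.
  by rewrite restrN// restrT ?add0r.
have := Tloc (in_Lp_restr mSc fLp); apply: filterS2 => w T0 -> Sw.
by rewrite scale1r T0 ?addr0// restrN//=; apply/not_notP.
Qed.

Variable C : R.
Hypothesis C0 : 0 <= C.
Hypothesis TC : forall f, in_Lp mu p f ->
  (bochner_norm mu p (T_ f) <= C%:E * bochner_norm mu p f)%E.

(** Let [Q] be the part of [S] where the bound fails by at least [1/(n+1)]. Testing the operator on
    [restr Q f] gives [(C * e + 1/(n+1)) * c <= C * e * c], impossible if [Q] has positive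
    measure. *)
Lemma local_bound f (S : set T) (e : R) : measurable S -> (mu S < +oo)%E ->
  in_Lp mu p f -> 0 <= e -> (forall w, S w -> rnorm (f w) <= e) ->
  {ae mu, forall w, S w -> rnorm (T_ f w) <= C * e}.
Proof.
move=> mS Soo fLp e0 fe; have [TinLp _ _ _] := TLp.
suff : {ae mu, forall w, forall n : nat, S w -> rnorm (T_ f w) < C * e + n.+1%:R^-1}.
  apply: filterS => w h Sw; apply/ler_addgt0Pr => r r0.
  have /ltW /le_trans := h (Num.truncn r^-1) Sw; apply.
  by rewrite lerD2l invf_ple ?posrE// ltW// truncnS_gt.
apply: ae_foralln => n.
have n0 : 0 < n.+1%:R^-1 :> R by rewrite invr_gt0.
have [mTf _] := TinLp _ fLp; have [mf _] := fLp.
pose Q := S `&` [set w | C * e + n.+1%:R^-1 <= rnorm (T_ f w)].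
have mQ : measurable Q.
  apply: measurableI => //.
  have := measurable_rnorm mTf measurableT (measurable_itv `[C * e + n.+1%:R^-1, +oo[).
  by rewrite setTI; congr measurable; apply/seteqP; split=> w /=; rewrite in_itv/= andbT.
have QS : Q `<=` S by move=> w [].
have Qoo : (mu Q < +oo)%E by apply: le_lt_trans Soo; rewrite le_measure// inE.
have [Q0|Q0] := eqVneq (mu Q) 0%E.
  by exists Q; split=> // w /= /not_implyP[Sw] /negP; rewrite -leNgt; split.
exfalso.
have {}Q0 : (0 < mu Q)%E by rewrite lt_def Q0 measure_ge0.
have [c [c0 /(_ Q0) cgt0 Qc]] := Lnorm_indic p1 mQ Qoo.
have QLp := in_Lp_restr mQ fLp; have [mTQ _] := TinLp _ QLp.
have le1 : (((C * e + n.+1%:R^-1) * c)%:E <= bochner_norm mu p (T_ (restr Q f)))%E.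
  apply: (bochner_norm_lower mQ mTQ _ Qc); first by rewrite addr_ge0// ?mulr_ge0// ltW.
  by have := local_restr mQ fLp; apply: filterS => w Tw Qw; rewrite Tw//; case: Qw.
have le2 : (bochner_norm mu p (restr Q f) <= (e * c)%:E)%E.
  by apply: (bochner_norm_bounded mQ mf _ Qc) => // w /QS; exact: fe.
have := le_trans le1 (le_trans (TC QLp) (lee_wpmul2l _ le2)).
rewrite lee_fin C0 => /(_ isT); rewrite -EFinM lee_fin mulrA mulrDl gerDl.
by rewrite leNgt mulr_gt0.
Qed.

(** This is [local_bound] for [f - c] on [S]. The constant is cut off at [A] instead of [S], so that
    one image serves for all subsets [S] of a piece. *)
Lemma local_bound_cst f (S A : set T) (c : E) (e : R) :
  measurable S -> measurable A -> S `<=` A -> (mu A < +oo)%E ->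
  in_Lp mu p f -> 0 <= e -> (forall w, S w -> rnorm (f w - c) <= e) ->
  {ae mu, forall w, S w -> rnorm (T_ f w - T_ (restr A (cst c)) w) <= C * e}.
Proof.
move=> mS mA SA Aoo fLp e0 fe; have [_ _ Tlin _] := TLp.
have Soo : (mu S < +oo)%E by apply: le_lt_trans Aoo; rewrite le_measure// inE.
have cLp := in_Lp_cst c mA Aoo.
have uE : (fun x => -1 *: restr S (restr A (cst c)) x + restr S f x) =
    restr S (fun w => f w - c).
  apply/funext => w; rewrite /restr; case: pselect => Sw; last first.
    by rewrite scaler0 addr0.
  by case: pselect => [Aw|/(_ (SA _ Sw))//]; rewrite scaleN1r addrC.
have uLp : in_Lp mu p (restr S (fun w => f w - c)).
  apply: (in_Lp_bounded (e := e)) => //.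
  by apply: strongly_measurable_subc; case: fLp.
have ub : forall w, S w -> rnorm (restr S (fun w => f w - c) w) <= e.
  by move=> w Sw; rewrite restrT//; exact: fe.
have Tu := Tlin (-1) _ _ (in_Lp_restr mS cLp) (in_Lp_restr mS fLp).
rewrite uE in Tu; near=> w => Sw.
have Tfw : T_ (restr S f) w = T_ f w by move: Sw; near: w; exact: local_restr.
have Tcw : T_ (restr S (restr A (cst c))) w = T_ (restr A (cst c)) w.
  by move: Sw; near: w; exact: local_restr.
rewrite -Tfw -Tcw addrC -scaleN1r -(near Tu w)//.
by move: Sw; near: w; exact: local_bound uLp e0 ub.
Unshelve. all: by end_near. Qed.

End Lp_dual.

(** * The projective tensor product *)

(** Treats both scalar fields at once: a Cauchy sequence is bounded, so it converges along an
    ultrafilter finer than [\oo], and then along [\oo] itself. *)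
Lemma scalar_cauchy_cvg (R : realType) (k : scalars) (x : nat -> scalar_field R k) :
  (forall e : R, 0 < e -> exists N, forall m n, (N <= m)%N -> (N <= n)%N ->
     rnorm (x m - x n : (scalar_field R k)^o) < e) ->
  exists z : scalar_field R k, x @ \oo --> z.
Proof.
move=> xC; have [V [UV ooV]] := ultraFilterLemma (@eventually_filter).
have [N NP] := xC 1 ltr01.
have [|z xz] := @ultra_cvg R k nat V x (rnorm (x N : (scalar_field R k)^o) + 1) UV.
  apply: ooV; exists N => // n /= Nn.
  have := NP _ _ Nn (leqnn N); have := ler_rnorm_dist (x n : (scalar_field R k)^o) (x N) 0.
  by rewrite !subr0; lra.
exists z; apply/cvgP_rn => e e0.
have e20 : 0 < e / 2 by rewrite divr_gt0.
have [P PP] := xC _ e20.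
exists P => // n /= Pn; have VF := @ultra_proper _ _ UV.
have /filter_ex[m [Pm zm]] : V ([set m | (P <= m)%N] `&`
    [set m | rnorm (z - x m : (scalar_field R k)^o) < e / 2]).
  by apply: filterI; [apply: ooV; exists P|exact: (cvgP_rn _ x z).1 xz _ e20].
have := PP _ _ Pm Pn; have := ler_rnorm_dist (z : (scalar_field R k)^o) (x m) (x n).
by move: zm => /=; lra.
Qed.

Section projective_norm.
Context {R : realType} {k : scalars}.
Local Notation K := (scalar_field R k).
Variables E F : normedModType K.
Implicit Types s t : tensor E F.

Let cost s : R := \sum_(z <- s) rnorm z.1 * rnorm z.2.

Let cost_ge0 s : 0 <= cost s.
Proof. by apply: sumr_ge0 => z _; rewrite mulr_ge0 ?rnorm_ge0. Qed.

Let projective_norm_le s t : tensor_eq s t -> projective_norm s <= cost t.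
Proof.
move=> st; apply: ge_inf; last by exists t.
by exists 0 => _ [t' _ <-]; exact: cost_ge0.
Qed.

Let le_projective_norm s c : (forall t, tensor_eq s t -> c <= cost t) ->
  c <= projective_norm s.
Proof.
move=> sc; apply: lb_le_inf; first by exists (cost s), s.
by move=> _ [t st <-]; exact: sc.
Qed.

Lemma projective_norm_ge0 s : 0 <= projective_norm s.
Proof. by apply: le_projective_norm => t _; exact: cost_ge0. Qed.

(** A representative of [t] followed by one of [tensor_sub s t] represents [s]. *)
Lemma projective_norm_triangle s t :
  projective_norm s <= projective_norm t + projective_norm (tensor_sub s t).
Proof.
rewrite -lerBlDr; apply: le_projective_norm => t' tt'.
rewrite lerBlDr addrC -lerBlDr; apply: le_projective_norm => r' rr'.
rewrite lerBlDr addrC; have -> : cost t' + cost r' = cost (t' ++ r').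
  by rewrite /cost big_cat.
apply: projective_norm_le => V b.
rewrite big_cat /= -(tt' V b) -(rr' V b) /tensor_sub big_cat big_map /=.
rewrite addrCA -big_split /= [X in _ + X]big1 ?addr0// => z _.
by rewrite linearNl subrr.
Qed.

(** Shows that the [lim] defining [ptensor_norm] is a genuine limit: the norms of a Cauchy sequence
    are Cauchy. *)
Lemma ptensor_norm_cvg (u : ptensor E F) :
  projective_norm (u n) @[n --> \oo] --> ptensor_norm u.
Proof.
have [z uz] : exists z : R, projective_norm (u n) @[n --> \oo] --> z.
  apply: (@scalar_cauchy_cvg R RealScalars) => e /(ptensor_cauchy u)[N NP].
  exists N => m n Nm Nn; rewrite /rnorm /=.
  have := NP m n Nm Nn; have := NP n m Nn Nm.
  have := projective_norm_triangle (u m) (u n).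
  have := projective_norm_triangle (u n) (u m).
  by rewrite ltr_norml => *; apply/andP; split; lra.
exact: cvgP uz.
Qed.

End projective_norm.

Section operator_pairing_bound.
Context {R : realType} {k : scalars}.
Local Notation K := (scalar_field R k).
Variable F : normedModType K.
Local Notation rn z := (rnorm (z : K^o)).

Lemma operator_pairing_cvg (S : 'L(dual F, dual F)) (u : ptensor (dual F) F) :
  tensor_pairing S (u n) @[n --> \oo] --> operator_pairing S u.
Proof.
have [z uz] : exists z : K, tensor_pairing S (u n) @[n --> \oo] --> z.
  apply: scalar_cauchy_cvg => e e0.
  have S1 : 0 < opnorm S + 1 by rewrite ltr_wpDl ?opnorm_ge0.
  have [N NP] := ptensor_cauchy u (divr_gt0 e0 S1).
  exists N => m n Nm Nn; rewrite -tensor_pairing_sub.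
  have := NP m n Nm Nn; rewrite ltr_pdivlMr// mulrC; apply: le_lt_trans.
  apply: (le_trans (tensor_pairing_le _ _)); rewrite mulrDl lerDl mul1r.
  exact: projective_norm_ge0.
exact: cvgP uz.
Qed.

Lemma operator_pairing_le (S : 'L(dual F, dual F)) (u : ptensor (dual F) F) :
  rn (operator_pairing S u) <= opnorm S * ptensor_norm u.
Proof.
have Su := (cvgP_rn _ _ _).1 (@operator_pairing_cvg S u).
have nu : opnorm S * projective_norm (u n) @[n --> \oo] --> opnorm S * ptensor_norm u.
  by apply: cvgM; [exact: cvg_cst|exact: ptensor_norm_cvg].
apply/ler_addgt0Pr => e e0.
have e20 : 0 < e / 2 by rewrite divr_gt0.
have [n [/= h1 h2]] : exists n, rn (operator_pairing S u - tensor_pairing S (u n)) < e / 2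
    /\ `|opnorm S * ptensor_norm u - opnorm S * projective_norm (u n)| < e / 2.
  apply: (@filter_ex _ \oo); apply: filterI; first exact: Su.
  by move/cvgrPdist_lt : nu; exact.
have h3 : rn (operator_pairing S u) <=
    rn (operator_pairing S u - tensor_pairing S (u n)) + rn (tensor_pairing S (u n)).
  by have := ler_rnorm_dist (operator_pairing S u : K^o) (tensor_pairing S (u n)) 0; rewrite !subr0.
have h4 : rn (tensor_pairing S (u n)) <= opnorm S * projective_norm (u n).
  exact: tensor_pairing_le.
by move: h2; rewrite ltr_norml => /andP[h2 _]; lra.
Qed.

Context {d : measure_display} {T : measurableType d}.
Variable mu : {measure set T -> \bar R}.

(** Measurability needs checking on elementary tensors only: a general pairing is a pointwise limit
    of finite sums of these. *)
Lemma operator_Lsigma_starP (M : T -> 'L(dual F, dual F)) (C : R) :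
  (forall w, opnorm (M w) <= C) ->
  (forall (x : dual F) v, scalar_measurable (fun w => (M w x : dual F) v)) ->
  operator_Lsigma_star mu M.
Proof.
move=> MC mM; split=> [u|].
  apply: (scalar_measurable_lim (f := fun n w => tensor_pairing (M w) (u n))).
    by move=> n; apply: scalar_measurable_sum => z; exact: mM.
  by move=> w; exact: operator_pairing_cvg.
apply: (@le_lt_trans _ _ (`|C|)%:E); last exact: ltry.
apply: ge_ereal_sup => _ [u u1 <-]; apply/ess_supP; apply: aeW => w.
rewrite lee_fin (le_trans (operator_pairing_le _ _))//.
rewrite (@le_trans _ _ (opnorm (M w)))//; last by rewrite (le_trans (MC w))// ler_norm.
by rewrite -[leRHS]mulr1 ler_wpM2l// opnorm_ge0.
Qed.

End operator_pairing_bound.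

(** * The multiplier *)

Section lifted_operator.
Context {d : measure_display} {T : measurableType d} {R : realType} {k : scalars}.
Local Notation K := (scalar_field R k).
Variable mu : {measure set T -> \bar R}.
Variable F : normedModType K.
Local Notation E := (dual F).
Local Notation rn z := (rnorm (z : K^o)).
Variable U : T -> set_system T.
Hypothesis UL : lifting_on mu measurable U.
Variable h : E -> T -> E.
Variable C : R.
Hypothesis C0 : 0 <= C.
Hypothesis h_linear : forall a x y,
  {ae mu, forall w, h (a *: x + y) w = a *: h x w + h y w}.
Hypothesis h_bound : forall x, {ae mu, forall w, rnorm (h x w) <= C * rnorm x}.

Lemma lifting_of_ae w (P : T -> Prop) : {ae mu, forall y, P y} -> U w P.
Proof. by case: UL => _ UN _ /(UN w); rewrite setCK. Qed.

(** The value at [v] of the lifting of [h x]. Since [U w] contains all conull sets, relations that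
    hold almost everywhere between the [h x] hold for these limits at every [w]. *)
Definition lifted_value w x v : K := lim ((h x y v : K) @[y --> U w]).

Lemma lifted_value_cvg w x v : (h x y v : K) @[y --> U w] --> lifted_value w x v.
Proof.
have [|z hz] := @ultra_cvg R k T (U w) (fun y => h x y v) (C * rnorm x * rnorm v)
  (lifting_ultra UL w).
  apply: lifting_of_ae; apply: filterS (h_bound x) => y hy.
  by apply: (le_trans (dual_le _ _)); rewrite ler_wpM2r ?rnorm_ge0.
exact: cvgP hz.
Qed.

Lemma lifted_value_unique w x v z : (h x y v : K) @[y --> U w] --> z ->
  lifted_value w x v = z.
Proof.
move=> hz; have UF := lifting_filter UL w.
apply: (@cvg_unique _ (norm_hausdorff (V := K^o))  _ _ _ _ (@lifted_value_cvg w x v)).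
exact: hz.
Qed.

Lemma lifted_value_bound w x v : rn (lifted_value w x v) <= C * rnorm x * rnorm v.
Proof.
have UF := lifting_filter UL w.
apply/ler_addgt0Pr => e e0.
have he : U w [set y | rn (lifted_value w x v - h x y v) < e].
  exact: (cvgP_rn _ _ _).1 (@lifted_value_cvg w x v) _ e0.
have [y [hy1 hy2]] := filter_ex (@filterI _ _ UF _ _ he (lifting_of_ae w (h_bound x))).
have := ler_rnorm_dist (lifted_value w x v : K^o) (h x y v) 0; rewrite !subr0.
have := dual_le (h x y) v; have := ler_wpM2r (rnorm_ge0 v) hy2.
by move: hy1 => /=; lra.
Qed.

Lemma lifted_value_linearr w x : linear (lifted_value w x : F -> K^o).
Proof.
have UF := lifting_filter UL w.
move=> a u v; apply: lifted_value_unique.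
under eq_fun do rewrite linearP.
apply: cvgD; last exact: lifted_value_cvg.
by apply: cvgM; [exact: cvg_cst|exact: lifted_value_cvg].
Qed.

(** The exceptional set of [h_linear] varies with [a], [x] and [y], but its complement always
    belongs to [U w]. *)
Lemma lifted_value_linearl w a x y v :
  lifted_value w (a *: x + y) v = a * lifted_value w x v + lifted_value w y v.
Proof.
have UF := lifting_filter UL w.
apply: lifted_value_unique; apply/cvgP_rn => e e0.
have h2 : (a * h x z v + h y z v : K) @[z --> U w] -->
    a * lifted_value w x v + lifted_value w y v.
  apply: cvgD; last exact: lifted_value_cvg.
  by apply: cvgM; [exact: cvg_cst|exact: lifted_value_cvg].
have he := (cvgP_rn UF _ _).1 h2 _ e0; move: he.
by apply: filterS2 (lifting_of_ae w (h_linear a x y)) => z ->.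
Qed.

(** The bilinear form [lifted_value w] is curried: [operator_of_bound] is used first in [v], giving
    [N w x] in the dual, then in [x]. *)
Lemma lifted_operator : exists M : T -> 'L(E, E),
  (forall w x v, (M w x : E) v = lifted_value w x v) /\
  (forall w, opnorm (M w) <= C).
Proof.
have M1 w x : exists S : E, forall v, S v = lifted_value w x v.
  apply: (operator_of_bound (c := C * rnorm x)) => [|v].
    exact: lifted_value_linearr.
  exact: lifted_value_bound.
pose N w x := sval (cid (M1 w x)).
have NE w x v : N w x v = lifted_value w x v := svalP (cid (M1 w x)) v.
have Nb w x : rnorm (N w x) <= C * rnorm x.
  rewrite (rnorm_opnorm (N w x)); apply: opnorm_le_bound => [|v].
    by rewrite mulr_ge0 ?rnorm_ge0.
  by rewrite NE lifted_value_bound.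
have M2 w : exists S : 'L(E, E), forall x, S x = N w x.
  apply: (operator_of_bound (c := C)) => [a x y|x]; last exact: Nb.
  apply/val_inj/funext => v; rewrite [LHS]NE.
  by rewrite lifted_value_linearl -!NE.
pose M w := sval (cid (M2 w)); have ME w x : M w x = N w x := svalP (cid (M2 w)) x.
exists M; split=> [w x v|w]; first by rewrite ME NE.
by apply: opnorm_le_bound => // x; rewrite ME.
Qed.

(* At almost every point [w] and up to an arbitrarily small error in norm, a
   strongly measurable function is constant on a set of [U w]: hence a null set
   which does not depend on [v]. *)
Lemma lifted_value_ae (A : set T) x (f : T -> E) :
  measure_is_complete mu -> measurable A -> strongly_measurable mu f ->
  (forall w, A w -> h x w = f w) ->
  {ae mu, forall w, A w -> forall v, lifted_value w x v = h x w v}.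
Proof.
move=> mu_complete mA mf hf; have [_ /almost_separably_valuedP[e fe]] := mf.
pose S n m := A `&` [set y | rnorm (f y - e n) < m.+1%:R^-1].
have mS n m : measurable (S n m).
  apply: measurableI => //.
  have := strongly_measurable_rnorm mu_complete (e n) mf.
  move=> /(_ measurableT `]-oo, m.+1%:R^-1[%classic (measurable_itv _)).
  by rewrite setTI; congr measurable; apply/seteqP; split=> y /=; rewrite in_itv.
(* Only countably many sets [S n m] occur, hence a single null set, chosen before [v]. *)
have SU : {ae mu, forall w, forall n m, S n m w -> U w (S n m)}.
  apply: ae_foralln => n; apply: ae_foralln => m.
  by case: UL => _ _; exact.
apply: filterS2 SU fe => w SU fe Aw v; apply: lifted_value_unique.
have UF := lifting_filter UL w.
apply/cvgP_rn => r r0.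
have v1 : 0 < rnorm v + 1 by rewrite ltr_wpDl ?rnorm_ge0.
(* The values of [f] at two points of [S n m] are less than [q] apart, and evaluating at [v] costs a
   factor below [rnorm v + 1]. *)
pose q := r / (rnorm v + 1); have q0 : 0 < q by rewrite divr_gt0.
pose m := Num.truncn (2 / q).
have mr : m.+1%:R^-1 < q / 2.
  by rewrite invf_plt ?posrE ?divr_gt0// invf_div truncnS_gt.
have m0 : 0 < m.+1%:R^-1 :> R by rewrite invr_gt0.
have [n nw] := fe _ m0.
have Sw : S n m w by split.
apply: filterS (SU n m Sw) => y [Ay ny]; rewrite /= in ny.
rewrite (hf w)// (hf y)//.
have fwy : rnorm (f w - f y) < q.
  apply: le_lt_trans (ler_rnorm_dist _ (e n) _) _; rewrite (rnorm_dist (e n)).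
  by rewrite (splitr q); apply: ltrD; [exact: lt_trans nw mr|exact: lt_trans ny mr].
have -> : f w v - f y v = (f w - f y) v by [].
apply: (le_lt_trans (dual_le _ _)); move: fwy; rewrite ltr_pdivlMr//.
by apply: le_lt_trans; rewrite ler_wpM2l ?rnorm_ge0// lerDl.
Qed.

End lifted_operator.

(** * Extension of the multiplier identity from constants to all functions *)

Section local_operators.
Context {d : measure_display} {T : measurableType d} {R : realType} {k : scalars}.
Local Notation K := (scalar_field R k).
Variable mu : {measure set T -> \bar R}.
Hypothesis mu_complete : measure_is_complete mu.
Variables (p : \bar R) (p1 : (1 <= p)%E).
Variable F : normedModType K.
Local Notation E := (dual F).
Variable T_ : (T -> E) -> (T -> E).
Hypothesis TLp : Lp_operator mu p T_.
Hypothesis Tloc : local_operator mu p T_.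

(** Where [f] is close to [e n], [local_bound_cst] keeps [T_ f] close to the image of the constant
    [e n], which is [M w (e n)], and the bound on [M w] keeps this close to [M w (f w)]. The
    sequence [e] is countable, so the null sets combine. *)
Lemma local_operator_on_piece (M : T -> 'L(E, E)) (C : R) (A : set T) (f : T -> E) :
  0 <= C ->
  (forall f, in_Lp mu p f ->
    (bochner_norm mu p (T_ f) <= C%:E * bochner_norm mu p f)%E) ->
  (forall w, opnorm (M w) <= C) ->
  measurable A -> (mu A < +oo)%E ->
  (forall x, {ae mu, forall w, A w -> T_ (restr A (cst x)) w = M w x}) ->
  in_Lp mu p f -> {ae mu, forall w, A w -> T_ f w = M w (f w)}.
Proof.
move=> C0 TC MC mA Aoo TM fLp; have [[mf foo] [_ /almost_separably_valuedP[e fe]]] := (fLp, fLp.1).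
pose S n m := A `&` [set y | rnorm (f y - e n) < m.+1%:R^-1].
have mS n m : measurable (S n m).
  apply: measurableI => //.
  have := strongly_measurable_rnorm mu_complete (e n) mf.
  move=> /(_ measurableT `]-oo, m.+1%:R^-1[%classic (measurable_itv _)).
  by rewrite setTI; congr measurable; apply/seteqP; split=> y /=; rewrite in_itv.
have TS : {ae mu, forall w, forall n m, S n m w ->
    rnorm (T_ f w - T_ (restr A (cst (e n))) w) <= C * m.+1%:R^-1}.
  apply: ae_foralln => n; apply: ae_foralln => m.
  apply: (local_bound_cst mu_complete p1 TLp Tloc C0 TC) => //.
  - by move=> w [].
  - by move=> w [_ /ltW].
have TMe : {ae mu, forall w, forall n, A w -> T_ (restr A (cst (e n))) w = M w (e n)}.
  by apply: ae_foralln => n; exact: TM.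
apply: filterS3 TS TMe fe => w TS TMe fe Aw; apply/eqP; rewrite -subr_eq0; apply/eqP.
apply: rnorm_eq0; apply/eqP; rewrite eq_le rnorm_ge0 andbT.
apply/ler_addgt0Pr => r r0; rewrite add0r.
have C1 : 0 < C + 1 by rewrite ltr_wpDl.
(* The two errors, each at most [C * (q / 2)], add up to [C * q], which is at most [r]. *)
pose q := r / (C + 1); have q0 : 0 < q by rewrite divr_gt0.
pose m := Num.truncn (2 / q).
have mr : m.+1%:R^-1 <= q / 2.
  by rewrite invf_ple ?posrE ?divr_gt0// invf_div ltW// truncnS_gt.
have m0 : 0 < m.+1%:R^-1 :> R by rewrite invr_gt0.
have [n nw] := fe _ m0.
have h1 : rnorm (T_ f w - M w (e n)) <= C * (q / 2).
  rewrite -(TMe n)//; apply: (le_trans (TS n m _)); first by split.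
  by rewrite ler_wpM2l.
have h2 : rnorm (M w (e n) - M w (f w)) <= C * (q / 2).
  rewrite -linearB; apply: (le_trans (opnormP _ _)).
  apply: ler_pM; rewrite ?opnorm_ge0 ?rnorm_ge0 ?MC//.
  by rewrite rnorm_dist; exact: le_trans (ltW nw) mr.
apply: (le_trans (ler_rnorm_dist _ (M w (e n)) _)); apply: (le_trans (lerD h1 h2)).
rewrite -mulrDr -splitr /q mulrCA ger_pMr//.
by rewrite ler_pdivrMr// mul1r lerDl.
Qed.

End local_operators.

Theorem theorem4p2 (R : realType) (k : scalars)
    (d : measure_display) (Omega : measurableType d)
    (mu : {measure set Omega -> \bar R})
    (mu_complete : measure_is_complete mu)
    (mu_localizable : strictly_localizable mu)
    (p : \bar R) (p1 : (1 <= p)%E)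
    (F : completeNormedModType (scalar_field R k))
    (T : (Omega -> dual F) -> (Omega -> dual F))
    (T_bounded : Lp_operator mu p T) (T_local : local_operator mu p T) :
  exists M : Omega -> 'L(dual F, dual F),
    operator_Lsigma_star mu M /\
    forall f : Omega -> dual F, in_Lp mu p f ->
      {ae mu, forall w, T f w = multiplier M f w}.
Proof.
have [I [A [A_cover A_triv A_fin A_meas A_mu]]] := mu_localizable.
have ae_glue := localizable_ae mu_complete A_meas A_mu.
(* On a null space there is no lifting, as no proper filter contains the empty set; but there
   everything holds almost everywhere. *)
have [mu0|mu0] := eqVneq (mu [set: Omega]) 0%E.
  exists (fun=> 0); split; last by move=> f _; exact: measure0_ae.
  apply: (operator_Lsigma_starP _ (C := 0)) => [w|x v].
    by apply: opnorm_le => x _; rewrite -[_ x]/(0 : dual F) rnorm0.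
  exact: (scalar_measurable_cst 0).
have {}mu0 : (0 < mu [set: Omega])%E by rewrite lt_def mu0 measure_ge0.
have [U UL] := localizable_lifting mu_complete A_cover A_triv A_fin A_meas A_mu mu0.
have [TinLp Tae Tlin [C' TC']] := T_bounded.
pose C := `|C'|; have C0 : 0 <= C by exact: normr_ge0.
have TC f : in_Lp mu p f -> (bochner_norm mu p (T f) <= C%:E * bochner_norm mu p f)%E.
  move=> /TC' /le_trans; apply; apply: lee_wpmul2r; first exact: Lnorm_ge0.
  by rewrite lee_fin ler_norm.
have jP w := piece_index A_cover w; pose j w := sval (cid (jP w)).
have Aj w : A (j w) w := svalP (cid (jP w)).
(* A constant need not be in [L^p], so the images of its restrictions to the pieces are glued, each
   point using its own piece. *)
pose h (x : dual F) w := T (restr (A (j w)) (cst x)) w.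
have hE i x w : A i w -> h x w = T (restr (A i) (cst x)) w.
  by move=> Aw; rewrite /h (piece_index_uniq A_triv (Aj w) Aw).
have cLp i (x : dual F) : in_Lp mu p (restr (A i) (cst x)).
  by case: (A_fin i) => mA Aoo; exact: in_Lp_cst.
have h_lin a x y : {ae mu, forall w, h (a *: x + y) w = a *: h x w + h y w}.
  apply: ae_glue => i; have := Tlin a _ _ (cLp i x) (cLp i y).
  apply: filterS => w + Aw; rewrite !(hE i)// => <-; congr (T _ w).
  by apply/funext => z; rewrite /restr; case: pselect => // Az; rewrite scaler0 addr0.
have h_bd x : {ae mu, forall w, rnorm (h x w) <= C * rnorm x}.
  apply: ae_glue => i; have [mA Aoo] := A_fin i.
  have cb w : A i w -> rnorm (restr (A i) (cst x) w) <= rnorm x.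
    by move=> Aw; rewrite restrT.
  have := local_bound mu_complete p1 T_bounded T_local C0 TC mA Aoo (cLp i x)
    (rnorm_ge0 x) cb.
  by apply: filterS => w + Aw; rewrite (hE i)//; exact.
have [M [ME MC]] := lifted_operator UL C0 h_lin h_bd.
have Mh x : {ae mu, forall w, M w x = h x w}.
  apply: ae_glue => i; have [mA Aoo] := A_fin i.
  have [mT _] := TinLp _ (cLp i x).
  have := lifted_value_ae UL h_bd mu_complete mA mT (hE i x).
  apply: filterS => w hw Aw; apply/val_inj/funext => v.
  by rewrite [LHS]ME hw.
exists M; split.
  apply: (operator_Lsigma_starP _ MC) => x v.
  apply: (scalar_measurable_ae mu_complete (f := fun w => h x w v)).
    by apply: filterS (Mh x) => w ->.
  (* [h x] is glued from possibly uncountably many functions; its measurability is tested on each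
     piece, where it agrees with a single image under [T]. *)
  apply/scalar_measurableP => O oO; apply/A_meas => i; have [mA _] := A_fin i.
  have [mT _] := TinLp _ (cLp i x).
  have /scalar_measurableP/(_ O oO) mTO := strongly_measurable_eval v mT.
  rewrite (_ : _ `&` _ = (fun w => T (restr (A i) (cst x)) w v) @^-1` O `&` A i).
    exact: measurableI.
  by apply/seteqP; split=> w /= [Ow Aw]; split=> //; move: Ow; rewrite (hE i).
move=> f fLp; apply: ae_glue => i; have [mA Aoo] := A_fin i.
apply: (local_operator_on_piece mu_complete p1 T_bounded T_local C0 TC MC mA Aoo) => // x.
by apply: filterS (Mh x) => w -> Aw; rewrite (hE i).
Qed.
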